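(* Let $p$ and $p+2$ be twin prime powers (i.e. both are prime powers) satisfying $p>2$. There exists a $1$-rotational $(p(p+2)q+1,\ p(p+2)+1,\ 1)$-RBIBD over $\mathbb{F}_{p}^+ \times\mathbb{F}_{p+2}^+ \times \mathbb{F}_{q}^+$ for any prime power $q\equiv 1 \pmod{p(p+2)+1}$ with $q>Q((p(p+2)+1)/2,\,p(p+2))$.
   Context: $\mathbb{F}_q^+$ is the additive group of the finite field $\mathbb{F}_q$. For positive integers $d,m$, $$Q(d,m)=\tfrac14\left(U+\sqrt{U^2+4d^{m-1}m}\right)^2,\qquad U=\sum_{h=1}^m \binom{m}{h}(d-1)^h(h-1).$$ A $(v,k,\lambda)$-BIBD is a pair $(V,\mathcal{A})$ where $V$ is a set of $v$ points and $\mathcal{A}$ is a collection of $k$-subsets of $V$ (blocks) such that every $2$-subset of $V$ is contained in exactly $\lambda$ blocks of $\mathcal{A}$. It is resolvable (a $(v,k,\lambda)$-RBIBD) if there exists a partition $\mathcal{R}$ of $\mathcal{A}$ (a resolution) into parallel classes, each of which is a partition of $V$. An automorphism group of a $(v,k,\lambda)$-RBIBD $(V,\mathcal{A})$ with resolution $\mathcal{R}$ is a group of permutations of $V$ leaving both $\mathcal{A}$ and $\mathcal{R}$ invariant. A $(v,k,\lambda)$-RBIBD is $1$-rotational over a group $G$ of order $v-1$ if it admits $G$ as an automorphism group fixing one point and acting sharply transitively on the other points. *)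

(* Defs.v *)
From HB Require Import structures.
From mathcomp Require Import all_boot all_order all_algebra all_fingroup.

Set Implicit Arguments.
Unset Strict Implicit.
Unset Printing Implicit Defensive.

Import Order.TTheory GRing.Theory Num.Theory.

Definition prime_power (n : nat) : Prop :=
  exists r e : nat, [/\ prime r, 0 < e & n = r ^ e].

(* The truncated subtractions of the informal formula are avoided by
   subtracting in R; only the exponent m - 1 is m.-1, for m positive. *)
Definition U_bound (R : rcfType) (d m : nat) : R :=
  (\sum_(1 <= h < m.+1) 'C(m, h)%:R * (d%:R - 1) ^+ h * (h%:R - 1))%R.

Definition Q_bound (R : rcfType) (d m : nat) : R :=
  (1 / 4 * (U_bound R d m +
     Num.sqrt (U_bound R d m ^+ 2 + 4 * d%:R ^+ m.-1 * m%:R)) ^+ 2)%R.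

(* Points are the elements of V; blocks form a set, so that the design has no
   repeated block (automatic when lambda = 1 and k >= 2). *)
Definition is_BIBD (V : finType) (v k lambda : nat) (A : {set {set V}}) : Prop :=
  [/\ #|V| = v,
      forall B : {set V}, B \in A -> #|B| = k &
      forall e : {set V}, #|e| = 2 -> #|[set B in A | e \subset B]| = lambda].

Definition is_resolution (V : finType) (A : {set {set V}})
    (Rs : {set {set {set V}}}) : Prop :=
  partition Rs A /\
  forall P : {set {set V}}, P \in Rs -> partition P [set: V].

Definition is_RBIBD (V : finType) (v k lambda : nat) (A : {set {set V}})
    (Rs : {set {set {set V}}}) : Prop :=
  is_BIBD v k lambda A /\ is_resolution A Rs.

Definition is_automorphism_group (V : finType) (A : {set {set V}})
    (Rs : {set {set {set V}}}) (H : {group {perm V}}) : Prop :=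
  [acts H, on A | 'P^*] /\ [acts H, on Rs | 'P^*^*].

Definition fixes_one_sharply_transitive (V : finType)
    (H : {group {perm V}}) : Prop :=
  exists oo : V,
    (forall g : {perm V}, g \in H -> g oo = oo) /\
    (forall x y : V, x != oo -> y != oo ->
       exists! g : {perm V}, g \in H /\ g x = y).

Definition one_rotational (V : finType) (A : {set {set V}})
    (Rs : {set {set {set V}}}) (gT : finGroupType) (G : {group gT}) : Prop :=
  #|G| = #|V|.-1 /\
  exists H : {group {perm V}},
    [/\ H \isog G, is_automorphism_group A Rs H
      & fixes_one_sharply_transitive H].

Definition exists_one_rotational_RBIBD (v k lambda : nat)
    (gT : finGroupType) (G : {group gT}) : Prop :=
  exists (V : finType) (A : {set {set V}}) (Rs : {set {set {set V}}}),
    is_RBIBD v k lambda A Rs /\ one_rotational A Rs G.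

(* Main.v *)
Require Import Defs.
From HB Require Import structures.
From mathcomp Require Import all_boot all_order all_algebra all_fingroup.
From mathcomp Require Import all_solvable all_field.
From mathcomp Require Import zify ring lra.
Import Order.TTheory GRing.Theory Num.Theory.

(** Write k = p (p + 2) + 1 = 2 d, so that d = (p + 1)^2 / 2, put H = F_p x F_(p+2)
and K = F_q, let c = (q - 1) / d, and call x^c the label of a nonzero x in K; the
labels are the d-th roots of unity and the fibres of the label map are the cosets of
the group of d-th powers.

The design. The complement D of the twin prime power difference set of H has d
elements, and every nonzero element of H is a difference of D in exactly d / 2 ways
([card_twin_set], [twin_set_diff]). Choose a value a_t in K for each t in D and let B
consist of the 2 d = k points (t, a_t) and (t, - a_t). The differences of B with first
coordinate w have as second coordinates, up to sign, the 2 a_t if w = 0, and otherwise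
the a_t - a_t' and a_t + a_t' with t - t' = w; either way these are d values up to
sign. Suppose that in each case the d values have distinct labels, and likewise the
a_t. Let S contain one element of each pair w, - w of elements of label 1 (-1 has
label 1). Then the multiples of B by S have every difference with nonzero second
coordinate exactly once, and their second coordinates run exactly once through the
nonzero elements of K. So the translates of these multiples, with the blocks
consisting of the fixed point and a coset of H, form the design, and those obtained by
translating along H form, with H and the fixed point, one parallel class; the other
classes are the translates of it ([rot_RBIBD], [rot_one_rotational],
[starter_one_rotational]).

The values a_t. To each pair t, t' assign one of the d / 2 blocks {2r, 2r + 1} of
exponents, so that the pairs with a given difference receive all blocks ([slot_inj],
[slot_surj]); it suffices that the labels of a_t - a_t' and a_t + a_t' are the two
powers z^(2r), z^(2r + 1), in either order, where z is a primitive d-th root of unity.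
The values are chosen one after another ([greedy_choice]); when n of them are known,
the next one has to meet m = 2 n + 1 conditions on labels of x - b_i, with 2^n
admissible families of labels.

Existence of such x. If there were none, Parseval's identity and the Cauchy-Schwarz
inequality would give a nontrivial multiplicative character chi and exponents e_i for
which the sum over x of chi(prod_i (x - b_i)^(e_i)) is large ([empty_cells_le]).
Weil's theorem would bound that sum by (m - 1) sqrt q; here a weaker bound, about 2
d^2 sqrt q, is proved by Stepanov's method, and the gain by the factor 2^n makes up
for the loss ([cell_room], [exists_in_cells]). The method bounds from above the number
of x for which prod_i (x - b_i)^(e_i) lies in a given coset of the n-th powers, n
being now the order of the character: one constructs a nonzero polynomial of small
degree that vanishes to high order at all these x ([stepanov_count]). It is a
combination of products x^a g_k(x) (x^q - t)^j, where g_k takes the value y^k on the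
coset; it is nonzero because, modulo x^q - t and up to factors of small degree, the
g_k are the powers of an n-th root, of degree n, of a rational function
([kummer_indep], [kummer_indep_mod]). A bound from above is enough for a character
sum, since the n-th roots of unity have sum zero ([char_sum_le]). *)

Set Implicit Arguments.
Unset Strict Implicit.
Unset Printing Implicit Defensive.
Local Open Scope ring_scope.

(** * Binomials in a polynomial ring *)

(** The determinant of multiplication by X on L[X]/(D), that is the norm of the class
of X, serves as [delta]: this endomorphism has n-th power a. *)
Lemma dvdp_XnsubC_exp (L : fieldType) (D : {poly L}) (n : nat) (a : L) :
  D \is monic -> (1 < size D)%N -> D %| 'X^n - a%:P ->
  exists delta : L, delta ^+ n = a ^+ (size D).-1.
Proof.
move=> Dmon sD dvD.
have [s Es] : exists s, (size D).-1 = s.+1 by exists (size D).-2; lia.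
have [A EA] : exists A : 'M[L]_s.+1, char_poly A = D.
  by rewrite -Es; exists (companionmx D); rewrite companionmxK.
have := Cayley_Hamilton A; rewrite EA => DA.
case/dvdpP: dvD => w Ew.
have : horner_mx A ('X^n - a%:P) = 0 by rewrite Ew rmorphM /= DA mulr0.
rewrite rmorphB rmorphXn /= horner_mx_X horner_mx_C => /eqP; rewrite subr_eq0 => /eqP An.
have <- : \det (A ^+ n) = a ^+ (size D).-1 by rewrite An det_scalar Es.
exists (\det A).
by elim: n {Ew An} => [|n IHn]; rewrite ?expr0 ?det1 // !exprS det_mulmx IHn.
Qed.

(** The form of [dvdp_XnsubC_exp] without denominators. *)
Lemma dvdp_binomial_exp (L : fieldType) (D : {poly L}) (n : nat) (a c : L) :
  c != 0 -> (1 < size D)%N -> D %| c *: 'X^n - a%:P ->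
  exists delta : L, c ^+ (size D).-1 * delta ^+ n = a ^+ (size D).-1.
Proof.
move=> cn0 sD dvD.
have ln0 : (lead_coef D)^-1 != 0.
  by rewrite invr_eq0 lead_coef_eq0 -size_poly_gt0 (ltn_trans _ sD).
have D1m : (lead_coef D)^-1 *: D \is monic.
  by rewrite monicE lead_coefZ mulVf // -invr_eq0.
have [||delta Ed] := dvdp_XnsubC_exp D1m _ (n := n) (a := a / c).
- by rewrite size_scale.
- rewrite dvdpZl // -(@dvdpZr _ c) // scalerBr.
  have <- : (a)%:P = c *: (a / c)%:P by rewrite -mul_polyC -polyCM mulrC divfK.
  exact: dvD.
exists delta; rewrite Ed size_scale // expr_div_n mulrC divfK //.
by rewrite expf_neq0.
Qed.

(** Each term of the Leibniz formula contains one entry of every row. *)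
Lemma size_det (R : idomainType) n (A : 'M[{poly R}]_n) (u : 'I_n -> nat) :
  (forall i j, size (A i j) <= (u i).+1)%N -> (size (\det A) <= (\sum_i u i).+1)%N.
Proof.
move=> sA; rewrite /determinant.
apply: leq_trans (size_sum _ _ _) _; apply/bigmax_leqP => s _.
have -> : (-1) ^+ odd_perm s * \prod_i A i (s i)
  = ((-1) ^+ odd_perm s)%:P * \prod_i A i (s i).
  by rewrite rmorphXn rmorphN rmorph1.
rewrite mul_polyC.
apply: leq_trans (size_scale_leq _ _) _.
apply: leq_trans (size_poly_prod_leq _ _) _.
rewrite -sum1_card /=.
have : (\sum_(i < n) size (A i (s i)) <= \sum_(i < n) (u i + 1))%N.
  by apply: leq_sum => i _; rewrite addn1 sA.
rewrite big_split /=.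
by move=> le; rewrite leq_subLR addnS ltnS addnC.
Qed.

(** Comparison of the multiplicities of the root [b i] on both sides. *)
Lemma exponent_dvd_of_pow_eq (K : fieldType) m (b : 'I_m -> K) (e : 'I_m -> nat)
   (n s : nat) (g1 g2 : K) (u v : {poly K}) :
   injective b -> g1 != 0 -> g2 != 0 -> u != 0 -> v != 0 ->
   (\prod_i ('X - (b i)%:P) ^+ e i) ^+ s * u ^+ n * g1%:P = g2%:P * v ^+ n ->
   forall i, (n %| s * e i)%N.
Proof.
move=> binj g1n g2n un vn E i0.
have mupX (p : {poly K}) k : p != 0 -> mup (b i0) (p ^+ k) = (k * mup (b i0) p)%N.
  move=> pn; elim: k => [|k IH]; first by rewrite mupNroot // root1.
  by rewrite exprS mupM ?expf_neq0 // IH mulSn.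
have mupC (c : K) : c != 0 -> mup (b i0) c%:P = 0%N.
  by move=> cn; rewrite mupNroot // rootC.
pose f := \prod_i ('X - (b i)%:P) ^+ e i.
have fn : f != 0.
  by apply/prodf_neq0 => i _; rewrite expf_neq0 // polyXsubC_eq0.
have mf : mup (b i0) f = e i0.
  rewrite /f (bigD1 i0) //= mupMl; first by rewrite mup_XsubCX eqxx.
  rewrite rootE horner_prod; apply/prodf_neq0 => j jn.
  rewrite horner_exp hornerXsubC expf_eq0 subr_eq0 (inj_eq binj) eq_sym.
  by rewrite (negbTE jn) andbF.
have := congr1 (mup (b i0)) E.
rewrite -/f !mupM ?mulf_neq0 ?expf_neq0 ?polyC_eq0 // !mupC // !mupX // mf.
rewrite addn0 add0n => Eq.
by rewrite -(dvdn_addl _ (dvdn_mulr (mup (b i0) u) (dvdnn n))) Eq dvdn_mulr.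
Qed.

(** The degree of the resultant in the remaining variable: the Sylvester matrix has
[(size q).-1] rows made of coefficients of [p] and [(size p).-1] rows made of
coefficients of [q]. *)
Lemma size_resultant (R : idomainType) (p q : {poly {poly R}}) (a b : nat) :
  (forall i, size (p`_i)%R <= a.+1)%N -> (forall i, size (q`_i)%R <= b.+1)%N ->
  (size (resultant p q) <= ((size q).-1 * a + (size p).-1 * b).+1)%N.
Proof.
move=> sp sq; rewrite /resultant.
pose u (i : 'I_((size q).-1 + (size p).-1)) := if split i is inl _ then a else b.
apply: leq_trans (@size_det _ _ _ u _) _; last first.
  rewrite ltnS big_split_ord /=.
  under eq_bigr => i _ do rewrite /u (unsplitK (inl i)).
  under [X in (_ + X)%N]eq_bigr => i _ do rewrite /u (unsplitK (inr i)).
  by rewrite !big_const_ord !iter_addn_0 mulnC [X in (_ + X)%N]mulnC.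
move=> i j; rewrite Sylvester_mxE /u; case: (split i) => k.
  by rewrite mulrb; case: ifP; rewrite ?sp ?size_poly0.
by rewrite mulrb; case: ifP; rewrite ?sq ?size_poly0.
Qed.

Lemma fraction_num_den (R : idomainType) (x : {fraction R}) :
  exists u v : R, v != 0 /\ x * tofrac v = tofrac u.
Proof.
elim/quotW: x => r; exists \n_r, \d_r; split; first exact: denom_ratioP.
unlock tofrac; rewrite -[LHS]FracField.pi_mul; apply/eqP; rewrite piE.
rewrite FracField.equivfE /FracField.mulf /= !numden_Ratio ?mulf_neq0 ?oner_eq0 ?denom_ratioP //.
by rewrite !mulr1 mulrC.
Qed.

(** Let f be the product of the [('X - b i) ^+ e i]; then G is an n-th root of g / f
modulo [modulus]. If Phi were not zero, its resultant with f Y^n - g would be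
divisible by [modulus] and of smaller degree, hence zero, and Phi, of degree less than
n, would have a factor of some degree s > 0 in common with f Y^n - g over the rational
functions. Then f^s would be an n-th power up to a constant, which the condition on
the exponents [e] excludes. *)
Lemma kummer_indep (K : fieldType) m (b : 'I_m -> K) (e : 'I_m -> nat)
    (n a df : nat) (g : K) (modulus G : {poly K}) (Phi : {poly {poly K}}) :
  injective b -> (0 < n)%N ->
  (forall s, (forall i, n %| s * e i)%N -> (n %| s)%N) -> g != 0 ->
  (\sum_i e i <= df)%N ->
  modulus %| \prod_i ('X - (b i)%:P) ^+ e i * G ^+ n - g%:P ->
  modulus %| Phi.[G] -> (size Phi <= n)%N ->
  (forall i, size (Phi`_i)%R <= a.+1)%N -> (n * a + n * df < (size modulus).-1)%N ->
  Phi = 0.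
Proof.
move=> binj n0 He gn0 sdf dvPsi dvPhi sPhi aPhi small.
apply/eqP; apply: contraT => Phin0.
pose f := \prod_i ('X - (b i)%:P) ^+ e i.
have fn : f != 0.
  by apply/prodf_neq0 => i _; rewrite expf_neq0 // polyXsubC_eq0.
have sf : (size f <= df.+1)%N.
  rewrite /f size_prod; last by move=> i _; rewrite expf_neq0 // polyXsubC_eq0.
  under eq_bigr => i _ do rewrite size_exp_XsubC -addn1.
  rewrite big_split /= -sum1_card -addSn addnK ltnS //.
have dvd_small (c : {poly K}) : modulus %| c -> (size c <= (n * a + n * df).+1)%N -> c = 0.
  move=> dv sc; apply/eqP; apply: contraT => cn.
  move: small; rewrite ltn_predRL => /leq_trans/(_ (dvdp_leq cn dv)).
  by rewrite ltnNge sc.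
case: (ltnP 1 (size Phi)) => sPhi1; last first.
  have [c Ec] : exists c, Phi = c%:P by exists Phi`_0; apply: size1_polyC.
  move: dvPhi Phin0; rewrite Ec hornerC => /dvd_small ->; rewrite ?eqxx //.
  have := aPhi 0; rewrite Ec coefC /= => h; apply: leq_trans h _.
  by rewrite ltnS (leq_trans _ (leq_addr _ _)) // leq_pmull.
pose Psi : {poly {poly K}} := f *: 'X^n - g%:P%:P.
have sPsi : size Psi = n.+1.
  rewrite /Psi size_polyDl size_scale ?size_polyXn // size_polyN.
  by rewrite (leq_ltn_trans (size_polyC_leq1 _)).
have cPsi i : (size (Psi`_i)%R <= df.+1)%N.
  rewrite /Psi coefB coefZ coefXn coefC.
  case: eqP => [->|_]; case: eqP => [E|_]; rewrite ?mulr1 ?mulr0 ?subr0 //.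
  - by rewrite E in n0.
  - by rewrite sub0r size_polyN (leq_trans (size_polyC_leq1 _)).
  - by rewrite size_poly0.
have [|uv _ Ruv] := resultant_in_ideal sPhi1 _ (q:=Psi); first by rewrite sPsi ltnS.
have res0 : resultant Phi Psi = 0.
  apply: dvd_small.
    have -> : resultant Phi Psi = (uv.1 * Phi + uv.2 * Psi).[G] by rewrite -Ruv hornerC.
    rewrite hornerD !hornerM dvdp_add // dvdp_mull //.
    by rewrite /Psi hornerD hornerN hornerZ hornerXn hornerC.
  apply: leq_trans (size_resultant aPhi cPsi) _; rewrite sPsi /= ltnS leq_add2l leq_mul2r.
  by rewrite (leq_trans (leq_pred _) sPhi) orbT.
have := resultant_eq0 Phi Psi; rewrite res0 eqxx => /esym sD.
set D := gcdp Phi Psi in sD.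
have sDn : (size D <= n)%N by apply: leq_trans (dvdp_leq _ (dvdp_gcdl _ _)) sPhi.
have [[c w] /= cn0 Ew] := Pdiv.Idomain.dvdpP _ _ (dvdp_gcdr Phi Psi : D %| Psi).
pose L := {fraction {poly K}}.
pose i : {rmorphism {poly K} -> L} := @tofrac {poly K}.
have iinj (x : {poly K}) : (i x == 0) = (x == 0) by apply: tofrac_eq0.
pose DL := map_poly i D.
have sDL : size DL = size D.
  rewrite size_map_inj_poly ?rmorph0 // => x y /eqP; rewrite -subr_eq0 -rmorphB iinj subr_eq0.
  by move/eqP.
have dv1 : DL %| (i c * i f) *: 'X^n - (i (c * g%:P))%:P.
  have -> : (i c * i f) *: 'X^n - (i (c * g%:P))%:P = map_poly i (c *: Psi).
    rewrite linearZ /= /Psi rmorphB /= linearZ /= map_polyXn !map_polyC /=.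
    by rewrite scalerBr scalerA tofracM polyCM mul_polyC.
  by rewrite Ew rmorphM dvdp_mull.
have [||delta] := dvdp_binomial_exp _ _ dv1.
- by rewrite mulf_neq0 // iinj.
- by rewrite sDL.
rewrite sDL; set s := (size D).-1 => Ed.
have /andP[s1 s2] : (0 < s < n)%N by rewrite /s; move: sD sDn; clear; case: (size D) => [|[|k]].
have [u [v [vn0 Euv]]] := fraction_num_den delta.
have Efin : c ^+ s * f ^+ s * u ^+ n = (c * g%:P) ^+ s * v ^+ n.
  apply/eqP; rewrite -subr_eq0 -iinj rmorphB subr_eq0 /=; apply/eqP.
  by rewrite !tofracM !tofracXn -Euv exprMn mulrA -Ed exprMn.
have gs0 : g ^+ s != 0 by rewrite expf_neq0.
have Efin1 : f ^+ s * u ^+ n * 1%:P = (g ^+ s)%:P * v ^+ n.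
  apply: (mulfI (expf_neq0 s cn0)).
  by rewrite mulr1 rmorphXn mulrA Efin exprMn mulrA.
have un0 : u != 0.
  apply: contraTneq vn0 => u0; move: Efin1.
  rewrite u0 expr0n -[n == 0%N]negbK -lt0n n0 /= mulr0 mul0r => /esym/eqP.
  by rewrite mulf_eq0 polyC_eq0 (negbTE gs0) expf_eq0 n0 /= negbK.
have := exponent_dvd_of_pow_eq binj (oner_neq0 _) gs0 un0 vn0 Efin1.
by move/He/dvdn_leq => /(_ s1); rewrite leqNgt s2.
Qed.

(** * Linear systems and Hasse derivatives *)

Lemma exists_kernel_vector (K : fieldType) (T T' : finType) (A : {set T})
    (M : T -> T' -> K) : (#|T'| < #|A|)%N ->
  exists rho : T -> K, [/\ forall t, t \notin A -> rho t = 0,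
    exists t, rho t != 0 & forall t', \sum_t rho t * M t t' = 0].
Proof.
move=> lt.
pose Mx := \matrix_(i < #|A|, j < #|T'|) M (enum_val i) (enum_val j).
have kn0 : kermx Mx != 0.
  by rewrite kermx_eq0 /row_free neq_ltn (leq_ltn_trans (rank_leq_col _) lt).
have /rowV0Pn[v /sub_kermxP vM vn0] := kn0.
pose rho t := \sum_(i < #|A|) (enum_val i == t)%:R * v 0 i.
have rhoE (i : 'I_#|A|) : rho (enum_val i) = v 0 i.
  rewrite /rho (bigD1 i) //= eqxx mul1r big1 ?addr0 // => j jn.
  by rewrite (inj_eq enum_val_inj) (negbTE jn) mul0r.
exists rho; split.
- move=> t tA; rewrite /rho big1 // => i _; case: eqP => [E|_]; last by rewrite mul0r.
  by rewrite -E enum_valP in tA.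
- have /rV0Pn[i vi] := vn0; exists (enum_val i); rewrite rhoE //.
- move=> t'; have := congr1 (fun w : 'rV_ _ => w 0 (enum_rank t')) vM; rewrite !mxE => E.
  rewrite -[RHS]E (bigID (mem A)) /= [X in _ + X]big1 ?addr0; last first.
    move=> t tA; rewrite [rho t]big1 ?mul0r // => i _; case: eqP => [Et|_]; last by rewrite mul0r.
    by rewrite -Et enum_valP in tA.
  rewrite (big_enum_val (fun t => rho t * M t t')) /=.
  by apply: eq_bigr => i _; rewrite mxE enum_rankK rhoE.
Qed.

Lemma hasse_mulX (K : comNzRingType) (p : {poly K}) (b : K) l :
  (p * ('X - b%:P))^`N(l.+1) = p^`N(l.+1) * ('X - b%:P) + p^`N(l).
Proof.
have := nderivnMXaddC l p 0; rewrite addr0 => E.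
rewrite !mulrBr nderivnB E [p * b%:P]mulrC mul_polyC nderivnZ -mul_polyC.
by ring.
Qed.

(** By induction on [N], from the Leibniz rule for one linear factor. *)
Lemma dvdp_hasse (K : fieldType) (u : {poly K}) (b : K) N l :
  ('X - b%:P) ^+ (N - l) %| (u * ('X - b%:P) ^+ N)^`N(l).
Proof.
elim: N l => [|N IH] [|l].
- by rewrite expr0 dvd1p.
- by rewrite expr0 dvd1p.
- by rewrite nderivn0 dvdp_mull.
rewrite exprSr mulrA hasse_mulX subSS dvdp_add //.
have := IH l.+1; case: (leqP N l) => h; first by rewrite (eqP h) dvd1p.
have -> : (N - l = (N - l.+1).+1)%N by lia.
by rewrite exprSr => h1; rewrite dvdp_mul.
Qed.

Lemma size_hasse (K : nzRingType) (u : {poly K}) l : (size u^`N(l) <= size u - l)%N.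
Proof.
apply/leq_sizeP => j hj; rewrite coef_nderivn nth_default ?mul0rn //.
by rewrite -leq_subLR.
Qed.

(** Taylor's formula. Hasse derivatives make it valid even when M exceeds the
characteristic. *)
Lemma hasse_vanish_dvdp (K : fieldType) (u : {poly K}) (x : K) M :
  (forall l, (l < M)%N -> u^`N(l).[x] = 0) -> ('X - x%:P) ^+ M %| u.
Proof.
move=> H.
have E : u \Po ('X + x%:P) = \sum_(i < size u) (u^`N(i).[x])%:P * 'X^i.
  rewrite /comp_poly addrC nderiv_taylor; last exact: mulrC.
  by rewrite size_map_polyC; apply: eq_bigr => i _; rewrite nderivn_map horner_map.
have : 'X^M %| u \Po ('X + x%:P).
  rewrite E; elim/big_ind: _ => [|u1 u2|i _]; [exact: dvdp0 | exact: dvdp_add |].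
  case: (ltnP i M) => h; first by rewrite H // mul0r dvdp0.
  by rewrite dvdp_mull // dvdp_exp2l.
move/(dvdp_comp_poly ('X - x%:P)); rewrite -comp_polyA comp_polyD comp_polyX comp_polyC.
by rewrite subrK comp_polyXr comp_Xn_poly.
Qed.

(** * Independence of the Kummer monomials *)

(** The polynomial X^q - X is the product of all [X - x], hence invariant under
translation. *)
Lemma XsubC_expcard (K : finFieldType) (b : K) :
  ('X - b%:P) ^+ #|K| = 'X^#|K| - b%:P.
Proof.
have E : forall c, ('X - c%:P) ^+ #|K| - ('X - c%:P) = \prod_(x : K) ('X - (x + c)%:P).
  move=> c; have := congr1 (comp_poly ('X - c%:P)) (finField_genPoly K).
  rewrite comp_polyB comp_Xn_poly comp_polyX => ->.
  rewrite rmorph_prod; apply: eq_bigr => x _ /=.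
  by rewrite comp_polyB comp_polyX comp_polyC rmorphD /= opprD addrA addrAC.
have E0 : \prod_(x : K) ('X - (x + b)%:P) = \prod_(x : K) ('X - x%:P).
  rewrite [RHS](reindex (fun x => x + b)) //=.
  by exists (fun x => x - b) => x _; rewrite ?addrK ?subrK.
have := E b; rewrite E0 -finField_genPoly => /eqP; rewrite subr_eq => /eqP ->.
by rewrite addrA subrK.
Qed.

Lemma dvdpB_prod (K : fieldType) (p : {poly K}) (I : Type) (r : seq I) (F H : I -> {poly K}) :
  (forall i, p %| F i - H i) -> p %| \prod_(i <- r) F i - \prod_(i <- r) H i.
Proof.
move=> FH; elim: r => [|i r IH]; first by rewrite !big_nil subrr dvdp0.
rewrite !big_cons.
have -> : F i * \prod_(j <- r) F j - H i * \prod_(j <- r) H j =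
  (F i - H i) * \prod_(j <- r) F j + H i * (\prod_(j <- r) F j - \prod_(j <- r) H j).
  by ring.
by apply: dvdp_add; [apply: dvdp_mulr | apply: dvdp_mull].
Qed.

Lemma dvdpB_exp (K : fieldType) (p u v : {poly K}) k : p %| u - v -> p %| u ^+ k - v ^+ k.
Proof. by move=> uv; rewrite subrXX dvdp_mulr. Qed.

Section KummerMonomials.
Variables (K : finFieldType) (m : nat) (b : 'I_m -> K) (e : 'I_m -> nat) (n c : nat).
Hypotheses (b_inj : injective b) (e_lt : forall i, (e i < n)%N) (n_gt1 : (1 < n)%N)
  (cn : (c * n)%N = #|K|.-1)
  (e_prim : forall s, (forall i, n %| s * e i)%N -> (n %| s)%N).
Let q := #|K|.

Definition kummer_exp k i := ((k * e i) %% n)%N.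
(** Up to reduction of the exponents modulo q - 1, which does not change values at
points other than the [b i], this is the k-th power of the product of the [('X - b i)
^+ (c * e i)]. *)
Definition kummer_mon k : {poly K} := \prod_i ('X - (b i)%:P) ^+ (c * kummer_exp k i).
Definition kummer_deg k := (\sum_i kummer_exp k i)%N.

Lemma size_prod_XsubC_exp (N : 'I_m -> nat) :
  size (\prod_i ('X - (b i)%:P) ^+ N i) = (\sum_i N i).+1.
Proof.
rewrite size_prod; last by move=> i _; rewrite expf_neq0 // polyXsubC_eq0.
under eq_bigr => i _ do rewrite size_exp_XsubC -addn1.
by rewrite big_split /= -sum1_card -addSn addnK.
Qed.

(** Modulo X^q - t the polynomial ['X - b i] has a constant q-th power. So the
[kummer_mon k] become, up to factors of small degree, the powers of one polynomial G
that is an n-th root of a rational function, and [kummer_indep] applies. *)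
Lemma kummer_indep_mod (t : K) (A : nat) (r : nat -> {poly K}) :
  (forall i, t != b i) -> (forall k, size (r k) <= A)%N ->
  (n * A + 2 * m * n ^ 2 < q)%N ->
  'X^q - t%:P %| \sum_(k < n) r k * kummer_mon k ->
  forall k, (k < n)%N -> r k = 0.
Proof.
move=> tb rA small dv.
have n0 : (0 < n)%N by apply: ltnW.
set p := 'X^q - t%:P in dv.
pose fl k i := ((k * e i) %/ n)%N.
have fl_lt k i : (k < n)%N -> (fl k i <= n)%N.
  move=> kn; apply: (@leq_trans (k * n %/ n)); last by rewrite mulnK // ltnW.
  by rewrite leq_div2r // leq_mul // ltnW.
pose beta k := \prod_i (t - b i) ^+ fl k i.
have tbn i : t - b i != 0 by rewrite subr_eq0.
have betan0 k : beta k != 0.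
  by apply/prodf_neq0 => i _; rewrite expf_neq0.
pose h k : {poly K} := \prod_i ('X - (b i)%:P) ^+ fl k i.
have hn0 k : h k != 0.
  by apply/prodf_neq0 => i _; rewrite expf_neq0 // polyXsubC_eq0.
pose r' k := (beta k)^-1 *: (r k * h k).
pose G : {poly K} := \prod_i ('X - (b i)%:P) ^+ (c * e i).
pose Phi : {poly {poly K}} := \poly_(k < n) r' k.
have frob i : p %| ('X - (b i)%:P) ^+ q - (t - b i)%:P.
  rewrite XsubC_expcard -/q polyCB.
  by have -> : 'X^q - (b i)%:P - (t%:P - (b i)%:P) = p by rewrite /p; ring.
have q1 : q = (c * n).+1 by rewrite cn prednK // /q; apply/card_gt0P; exists 0.
have hG k : h k * G ^+ k = kummer_mon k * \prod_i (('X - (b i)%:P) ^+ q) ^+ fl k i.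
  rewrite -prodrXl -!big_split /=; apply: eq_bigr => i _.
  rewrite -!exprM -!exprD; congr (_ ^+ _).
  rewrite q1 /kummer_exp /fl.
  have := divn_eq (k * e i) n; nia.
have dvt k : p %| r' k * G ^+ k - r k * kummer_mon k.
  have -> : r' k * G ^+ k - r k * kummer_mon k = (beta k)^-1 *: (r k * kummer_mon k *
     (\prod_i (('X - (b i)%:P) ^+ q) ^+ fl k i - \prod_i ((t - b i)%:P) ^+ fl k i)).
    rewrite /r' -scalerAl -[r k * h k * _]mulrA hG mulrBr scalerBr mulrA; congr (_ - _).
    have -> : \prod_i ((t - b i)%:P) ^+ fl k i = (beta k)%:P.
      by rewrite /beta rmorph_prod; apply: eq_bigr => i _; rewrite rmorphXn.
    by rewrite [_ * (beta k)%:P]mulrC mul_polyC scalerA mulVf // scale1r.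
  rewrite dvdpZr ?invr_eq0 // dvdp_mull //.
  by apply: dvdpB_prod => i; apply: dvdpB_exp.
have Phi0 : Phi = 0.
  apply: (@kummer_indep K m b e n (A + m * n) (m * n) (\prod_i (t - b i) ^+ e i) p G) => //.
  - by apply/prodf_neq0 => i _; rewrite expf_neq0.
  - rewrite -[X in (_ <= X * _)%N]card_ord -sum_nat_const; apply: leq_sum => i _.
    exact: ltnW.
  - have -> : \prod_i ('X - (b i)%:P) ^+ e i * G ^+ n =
        \prod_i (('X - (b i)%:P) ^+ q) ^+ e i.
      rewrite -prodrXl -big_split /=; apply: eq_bigr => i _.
      rewrite -!exprM -exprD; congr (_ ^+ _); rewrite q1; nia.
    rewrite rmorph_prod; apply: dvdpB_prod => i; rewrite rmorphXn; exact: dvdpB_exp.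
  - rewrite horner_poly -[X in _ %| X](subrK (\sum_(k < n) r k * kummer_mon k)).
    rewrite dvdp_add // -sumrB; elim/big_ind: _ => [|u v|k _]; [exact: dvdp0|exact: dvdp_add|].
    exact: dvt.
  - exact: size_poly.
  - move=> k; rewrite coef_poly; case: ltnP => kn; last by rewrite size_poly0.
    rewrite /r' (leq_trans (size_scale_leq _ _)) // (leq_trans (size_polyMleq _ _)) //.
    rewrite size_prod_XsubC_exp addnS /=.
    apply: leqW; rewrite leq_add // -[X in (_ <= X * _)%N]card_ord -sum_nat_const.
    by apply: leq_sum => i _; apply: fl_lt.
  - have -> : (size p).-1 = q.
      rewrite /p size_polyDl ?size_polyXn // size_polyN.
      by rewrite (leq_ltn_trans (size_polyC_leq1 _)) // q1.
    apply: leq_ltn_trans small; rewrite expnS expn1; nia.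
move=> k kn; have := congr1 (fun u : {poly {poly K}} => u`_k) Phi0.
rewrite coef_poly kn coef0 => /eqP; rewrite /r' scaler_eq0 invr_eq0 (negbTE (betan0 k)) /=.
by rewrite mulf_eq0 (negbTE (hn0 k)) orbF => /eqP.
Qed.

End KummerMonomials.

(** * Stepanov's method *)

(** The degree of [kummer_mon k] in units of q - 1, rounded up. *)
Definition kummer_ceil m (e : 'I_m -> nat) n k := ((kummer_deg e n k + n.-1) %/ n)%N.

Lemma kummer_deg_ceil m (e : 'I_m -> nat) n k : (0 < n)%N ->
  (kummer_deg e n k <= n * kummer_ceil e n k)%N.
Proof.
move=> n0; rewrite /kummer_ceil; set S := kummer_deg _ _ _.
have := divn_eq (S + n.-1) n; have := ltn_pmod (S + n.-1) n0; nia.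
Qed.

(** The summands for k and n - k add up to at most m + 1, because the residues of [k *
e i] and [(n - k) * e i] modulo n add up to 0 or n. *)
Lemma kummer_ceil_sum m (e : 'I_m -> nat) n : (1 < n)%N ->
  (2 * \sum_(k < n) kummer_ceil e n k <= n.-1 * m.+1)%N.
Proof.
move=> n1; case: n n1 => [//|n n1].
have c0 : kummer_ceil e n.+1 0 = 0%N.
  by rewrite /kummer_ceil /kummer_deg big1 ?add0n ?divn_small //.
rewrite big_ord_recl /= c0 add0n mul2n -addnn.
rewrite {2}(reindex_inj rev_ord_inj) -big_split /= -[X in (_ <= X * _)%N]card_ord -sum_nat_const.
apply: leq_sum => i _; rewrite /bump !add1n.
have -> : (n - i.+1).+1 = (n.+1 - i.+1)%N by have := ltn_ord i; lia.
set k := i.+1; have kn : (k < n.+1)%N by rewrite ltnS /k ltn_ord.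
have [m' m'm Em'] : exists2 m', (m' <= m)%N &
  (kummer_deg e n.+1 k + kummer_deg e n.+1 (n.+1 - k) = n.+1 * m')%N.
  exists (\sum_(j < m) ((k * e j) %% n.+1 != 0))%N.
    rewrite -[X in (_ <= X)%N]card_ord -sum1_card; apply: leq_sum => j _; exact: leq_b1.
  rewrite /kummer_deg -big_split big_distrr /=; apply: eq_bigr => j _.
  rewrite /kummer_exp mulnBl.
  have le : (k * e j <= n.+1 * e j)%N by rewrite leq_mul // ltnW.
  have Em := modnDm (k * e j) (n.+1 * e j - k * e j) n.+1.
  rewrite subnKC // modnMr in Em.
  have h1 := ltn_pmod (k * e j) (ltn0Sn n).
  have h2 := ltn_pmod (n.+1 * e j - k * e j) (ltn0Sn n).
  move: Em h1 h2; set x := (k * e j %% n.+1)%N; set y := (_ %% n.+1)%N.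
  move=> /eqP; rewrite -/(dvdn _ _) => /dvdnP[w Ew] h1 h2.
  have w2 : (w < 2)%N by nia.
  case: eqP => [x0|xn0] /=; first by case: w Ew w2 => [|[|]] //; nia.
  by case: w Ew w2 => [|[|]] //; nia.
rewrite /kummer_ceil; move: Em'; set S := kummer_deg _ _ _; set S' := kummer_deg _ _ _ => ES.
have := divn_eq (S + n) n.+1; have := divn_eq (S' + n) n.+1.
have := ltn_pmod (S + n) (ltn0Sn n); have := ltn_pmod (S' + n) (ltn0Sn n).
set u := (_ %/ _)%N; set u' := ((_ + _) %/ _)%N; set r := (_ %% _)%N; set r' := ((_ + _) %% _)%N.
move=> h1 h2 h3 h4.
have : (n.+1 * (u + u') < n.+1 * (m'.+2))%N by nia.
rewrite ltn_pmul2l //; lia.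
Qed.

Lemma prod_dvdp (K : fieldType) (I : eqType) (r : seq I) (F : I -> {poly K}) (w : {poly K}) :
  uniq r -> (forall i j, i != j -> coprimep (F i) (F j)) ->
  (forall i, i \in r -> F i %| w) -> \prod_(i <- r) F i %| w.
Proof.
move=> ur cop; elim: r ur => [_ _|i r IH]; first by rewrite big_nil dvd1p.
rewrite big_cons /= => /andP[ir ur] dv; rewrite Gauss_dvdp.
  by rewrite dv ?mem_head //= IH // => j jr; apply: dv; rewrite inE jr orbT.
elim: r ir {IH ur dv} => [_|j r IH]; first by rewrite big_nil coprimep1.
by rewrite inE negb_or big_cons coprimepMr => /andP[ij ir]; rewrite IH // cop.
Qed.

Lemma coprimep_XsubC_exp (K : fieldType) (x y : K) k l : x != y ->
  coprimep (('X - x%:P) ^+ k) (('X - y%:P) ^+ l).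
Proof.
move=> xy; rewrite coprimep_expl // coprimep_expr //.
by rewrite coprimep_XsubC root_XsubC eq_sym.
Qed.

(** Used to peel off the coefficients of a vanishing polynomial in powers of [p]. *)
Lemma dvdp_first_term (K : fieldType) (p : {poly K}) D (Q : nat -> {poly K}) j : p != 0 ->
  \sum_(i < D) p ^+ i * Q i = 0 -> (j < D)%N -> (forall i, (i < j)%N -> Q i = 0) -> p %| Q j.
Proof.
move=> pn0 E jD Q0.
have : p ^+ j.+1 %| p ^+ j * Q j.
  rewrite -dvdpNr; move/eqP: E; rewrite (bigD1 (Ordinal jD)) //= addrC addr_eq0 => /eqP <-.
  elim/big_ind: _ => [|u v|i ij]; [exact: dvdp0|exact: dvdp_add|].
  case: (ltngtP i j) => h; first by rewrite Q0 // mulr0 dvdp0.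
    by rewrite dvdp_mulr // dvdp_exp2l.
  by case/eqP: ij; apply: val_inj.
by rewrite exprSr dvdp_mul2l // expf_neq0.
Qed.

Section Stepanov.
Variables (K : finFieldType) (m : nat) (b : 'I_m -> K) (e : 'I_m -> nat) (n c : nat).
Hypotheses (b_inj : injective b) (e_lt : forall i, (e i < n)%N) (n_gt1 : (1 < n)%N)
  (cn : (c * n)%N = #|K|.-1) (m_gt0 : (0 < m)%N)
  (e_prim : forall s, (forall i, n %| s * e i)%N -> (n %| s)%N).
Let q := #|K|.
Let g k := kummer_mon b e n c k.
Let P := \prod_i ('X - (b i)%:P).

(** At a point where [g k] takes the value y^k, P^l times the l-th Hasse derivative of
['X^a * g k] is y^k times the value of this polynomial of small degree. Hence
vanishing at all points of a cell is implied by a polynomial identity. *)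
Definition hasse_quot l k a : {poly K} := (P ^+ l * ('X^a * g k)^`N(l)) %/ g k.

Lemma kummer_mon_neq0 k : g k != 0.
Proof. by apply/prodf_neq0 => i _; rewrite expf_neq0 // polyXsubC_eq0. Qed.

Lemma hasse_quotP l k a : hasse_quot l k a * g k = P ^+ l * ('X^a * g k)^`N(l).
Proof.
apply: divpK; set w := (X in _ %| X).
apply: prod_dvdp; first exact: index_enum_uniq.
  by move=> i j ij; apply: coprimep_XsubC_exp; rewrite (inj_eq b_inj).
move=> i _; rewrite /w /g /kummer_mon (bigD1 i) //= [X in 'X^a * X]mulrC mulrA.
set N := (c * _)%N; set u := 'X^a * _.
have -> : P = ('X - (b i)%:P) * \prod_(j | j != i) ('X - (b j)%:P) by rewrite /P (bigD1 i).
rewrite exprMn.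
apply: (@dvdp_trans _ (('X - (b i)%:P) ^+ l * ('X - (b i)%:P) ^+ (N - l))).
  by rewrite -exprD dvdp_exp2l //; lia.
by rewrite -mulrA dvdp_mul // dvdp_mull // dvdp_hasse.
Qed.

(** The degree of [g k] cancels: only the growth by m - 1 per derivative remains. *)
Lemma size_hasse_quot l k a : (size (hasse_quot l k a) <= a + l * m.-1 + 1)%N.
Proof.
case: (eqVneq (hasse_quot l k a) 0) => [->|Hn]; first by rewrite size_poly0.
have gn := kummer_mon_neq0 k.
have := congr1 (size : {poly K} -> nat) (hasse_quotP l k a).
rewrite size_mul // => E.
have Hs : (0 < size (hasse_quot l k a))%N by rewrite size_poly_gt0.
have gs : (0 < size (g k))%N by rewrite size_poly_gt0.
have Ps : size (P ^+ l) = (m * l).+1.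
  by rewrite /P -prodrXl size_prod_XsubC_exp sum_nat_const card_ord.
have h1 := size_polyMleq (P ^+ l) ('X^a * g k)^`N(l).
have h2 := size_hasse ('X^a * g k) l.
have h3 : (size ('X^a * g k)%R <= a + size (g k))%N.
  by apply: leq_trans (size_polyMleq _ _) _; rewrite size_polyXn.
rewrite Ps /= in h1.
have h4 : (0 < size ('X^a * g k)^`N(l))%N.
  rewrite size_poly_gt0; apply: contraNneq Hn => w0.
  by have := hasse_quotP l k a; rewrite w0 mulr0 => /eqP; rewrite mulf_eq0 (negbTE gn) orbF.
move: Hs gs h1 h2 h3 h4; rewrite -E; clear E.
move: (size (hasse_quot _ _ _)) (size (g k)) (size ('X^a * g k)) (size _^`N(l)).
move=> s1 s2 s3 s4 Hs gs h1 h2 h3 h4.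
have : (m * l = l + l * m.-1)%N by case: m m_gt0 => // m' _; rewrite mulnC mulnS.
lia.
Qed.

Lemma kummer_mon_horner y x k : (forall i, x != b i) ->
  \prod_i (x - b i) ^+ (c * e i) = y -> (g k).[x] = y ^+ k.
Proof.
move=> xb <-; rewrite /g horner_prod -prodrXl; apply: eq_bigr => i _.
rewrite horner_exp hornerXsubC -exprM -mulnA [(e i * k)%N]mulnC (divn_eq (k * e i) n) mulnDr.
rewrite exprD [X in X * _](_ : _ = 1) ?mul1r // mulnCA mulnC exprM cn.
have q0 : (0 < #|K|)%N by apply/card_gt0P; exists 0.
have x0 : x - b i != 0 by rewrite subr_eq0.
have -> : (x - b i) ^+ #|K|.-1 = 1.
  by apply: (mulfI x0); rewrite -exprS prednK // expf_card mulr1.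
by rewrite expr1n.
Qed.

(** The cell consists of the x with prod_i (x - b_i)^(c e_i) = y. The unknowns are the
coefficients of a combination R of the X^a g_k (X^q - t)^j with j small enough to keep
the degree of R at most A - 1 + q (D - 1). Near a point x of K the factor X^q - t
agrees with the constant x - t up to order q, so R vanishes to order M on the cell as
soon as M polynomials, the l-th of degree less than A + D + l (m - 1), are zero. By
[count] this linear system has a nontrivial solution; R is then nonzero by
[kummer_indep_mod], and counting roots with multiplicity gives the bound. *)
Lemma stepanov_count (y : K) (A D M : nat) :
  (n * A + 2 * m * n ^ 2 < q)%N -> (M <= q)%N -> (0 < D)%N ->
  (M * (A + D) + m.-1 * 'C(M, 2) < A * \sum_(k < n) (D - kummer_ceil e n k))%N ->
  (#|[set x : K | [forall i, x != b i] && (\prod_i (x - b i) ^+ (c * e i) == y)%R]| * M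
     <= A + q * D.-1)%N.
Proof.
move=> small Mq D0 count; set Z := [set x | _].
have q1 : (1 < q)%N.
  by apply: leq_trans _ (ltnW small); nia.
have [t tb] : exists t, forall i, t != b i.
  have lt : (#|[set b i | i : 'I_m]| < #|K|)%N.
    rewrite (leq_ltn_trans (leq_imset_card _ _)) // card_ord -/q.
    by apply: leq_ltn_trans _ small; nia.
  have /card_gt0P[t] : (0 < #|~: [set b i | i : 'I_m]|)%N by rewrite cardsCs setCK subn_gt0.
  rewrite inE => tn; exists t => i; apply: contraNneq tn => ->; exact: imset_f.
(* The unknowns, indexed by k, j, a, and the conditions: the coefficients of the l-th polynomial
   for each l < M. *)
pose T : finType := ('I_n * 'I_D * 'I_A)%type.
pose U := [set x : T | (x.1.2 < D - kummer_ceil e n x.1.1)%N].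
pose T' : finType := {l : 'I_M & 'I_(A + D + l * m.-1)}.
pose cond (x : T) (z : T') : K :=
  y ^+ x.1.1 * (hasse_quot (tag z) x.1.1 x.2 * ('X - t%:P) ^+ x.1.2)`_(tagged z).
have cardT' : #|{: T'}| = (M * (A + D) + m.-1 * 'C(M, 2))%N.
  rewrite card_tagged sumnE big_map enumT -/(index_enum _).
  under eq_bigr => l _ do rewrite card_ord.
  rewrite big_split /= sum_nat_const card_ord; congr (_ + _)%N.
  by rewrite -big_distrl /= mulnC -bin2_sum big_mkord.
have cardU : #|U| = (A * \sum_(k < n) (D - kummer_ceil e n k))%N.
  have -> : U = setX [set w : 'I_n * 'I_D | (w.2 < D - kummer_ceil e n w.1)%N] [set: 'I_A].
    by apply/setP => x; rewrite !inE andbT.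
  rewrite cardsX cardsT card_ord mulnC; congr (_ * _)%N.
  rewrite -sum1_card (eq_bigl (fun w : 'I_n * 'I_D => true && (w.2 < D - kummer_ceil e n w.1)%N));
    last by move=> w; rewrite inE.
  rewrite -(pair_big_dep (fun _ => true) (fun (k : 'I_n) (j : 'I_D) => (j < D - kummer_ceil e n k)%N)
    (fun _ _ => 1%N)) /=.
  apply: eq_bigr => k _.
  rewrite -(big_ord_widen D (fun _ => 1%N)) ?leq_subr //.
  by rewrite sum1_card card_ord.
have [|rho [rhoU [x0 rho0] rhoM]] := @exists_kernel_vector K T T' U cond.
  by rewrite cardT' cardU.
pose p : {poly K} := 'X^q - t%:P.
have sp : size p = q.+1.
  by rewrite /p size_polyDl ?size_polyXn // size_polyN (leq_ltn_trans (size_polyC_leq1 _)) // ltnS ltnW.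
have pn0 : p != 0 by rewrite -size_poly_eq0 sp.
pose R := \sum_(x : T) rho x *: ('X^(x.2) * g x.1.1 * p ^+ x.1.2).
have Rn0 : R != 0.
  apply: contra rho0 => /eqP R0.
  pose r (j : 'I_D) (k : nat) : {poly K} :=
    if insub k is Some k' then \sum_(a < A) rho (k', j, a) *: 'X^a else 0.
  pose Q (j : nat) : {poly K} := if insub j is Some j' then \sum_(k < n) r j' k * g k else 0.
  have RE : \sum_(j < D) p ^+ j * Q j = 0.
    rewrite -[RHS]R0 /R.
    rewrite (eq_bigr (fun x : T => rho (x.1.1, x.1.2, x.2) *: ('X^(x.2) * g x.1.1 * p ^+ x.1.2)));
      last by case=> [[k j] a].
    rewrite -(pair_bigA _ (fun kj a => rho (kj.1, kj.2, a) *: ('X^a * g kj.1 * p ^+ kj.2))) /=.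
    rewrite -(pair_bigA _ (fun k j => \sum_a rho (k, j, a) *: ('X^a * g k * p ^+ j))) /=.
    rewrite exchange_big /=; apply: eq_bigr => j _.
    rewrite /Q valK mulr_sumr; apply: eq_bigr => k _.
    rewrite /r valK mulr_suml mulr_sumr; apply: eq_bigr => a _.
    by rewrite -scalerAl -scalerAr mulrC.
  have key j : (j < D)%N -> forall j' : 'I_D, j' = j :> nat -> forall k a, rho (k, j', a) = 0.
    elim/ltn_ind: j => j IH jD j' jj'.
    have Qi i : (i < j)%N -> Q i = 0.
      move=> ij; rewrite /Q; case: insubP => // i' _ ii'.
      rewrite big1 // => k _; rewrite /r valK big1 ?mul0r // => a _.
      by rewrite (IH i ij _ i') ?scale0r // (ltn_trans ij).
    have := dvdp_first_term pn0 RE jD Qi.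
    rewrite /Q -jj' valK => dv k a.
    have sr k0 : (size (r j' k0) <= A)%N.
      rewrite /r; case: insubP => [k' _ _|_]; last by rewrite size_poly0.
      apply: leq_trans (size_sum _ _ _) _; apply/bigmax_leqP => a' _.
      by rewrite (leq_trans (size_scale_leq _ _)) // size_polyXn.
    have := kummer_indep_mod b_inj e_lt n_gt1 cn e_prim tb sr small dv (ltn_ord k).
    rewrite /r valK => /(congr1 (fun u : {poly K} => u`_a)); rewrite coef0 => <-.
    rewrite coef_sum (bigD1 a) //= coefZ coefXn eqxx mulr1 big1 ?addr0 // => a' aa'.
    by rewrite coefZ coefXn -[(_ == _)]/(a == a') eq_sym (negbTE aa') mulr0.
  by case: x0 => [[k j] a]; rewrite (key j (ltn_ord j) j).
have Rdvd x : x \in Z -> ('X - x%:P) ^+ M %| R.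
  rewrite inE => /andP[/forallP xb /eqP xy].
  pose u := \sum_(w : T) (rho w * (x - t) ^+ w.1.2) *: ('X^(w.2) * g w.1.1).
  rewrite -[R](subrK u) dvdp_add //.
    rewrite /R /u -sumrB; elim/big_ind: _ => [|u1 u2|w _]; [exact: dvdp0|exact: dvdp_add|].
    have -> : rho w *: ('X^(w.2) * g w.1.1 * p ^+ w.1.2) -
        (rho w * (x - t) ^+ w.1.2) *: ('X^(w.2) * g w.1.1) =
      (rho w *: ('X^(w.2) * g w.1.1)) * (p ^+ w.1.2 - ((x - t)%:P) ^+ w.1.2).
      by rewrite mulrBr scalerAl; congr (_ - _); rewrite -rmorphXn /= [RHS]mulrC mul_polyC scalerA mulrC.
    apply: dvdp_mull; apply: dvdpB_exp.
    have -> : p - (x - t)%:P = ('X - x%:P) ^+ q.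
      by rewrite XsubC_expcard /p polyCB; ring.
    exact: dvdp_exp2l.
  apply: hasse_vanish_dvdp => l lM.
  have Pn0 : P.[x] != 0.
    by rewrite /P horner_prod; apply/prodf_neq0 => i _; rewrite hornerXsubC subr_eq0.
  apply: (mulfI (expf_neq0 l Pn0)); rewrite mulr0.
  pose C := \sum_(w : T) (rho w * y ^+ w.1.1) *: (hasse_quot l w.1.1 w.2 * ('X - t%:P) ^+ w.1.2).
  have C0 : C = 0.
    apply/polyP => i; rewrite coef0 /C coef_sum.
    have [hi|hi] := ltnP i (A + D + l * m.-1).
      rewrite -[RHS](rhoM (existT _ (Ordinal lM) (Ordinal hi))).
      by apply: eq_bigr => w _; rewrite coefZ /cond /= mulrA.
    rewrite big1 // => w _; rewrite coefZ nth_default ?mulr0 //.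
    apply: leq_trans hi; apply: leq_trans (size_polyMleq _ _) _.
    rewrite size_exp_XsubC addnS /=.
    have h1 := size_hasse_quot l w.1.1 w.2; have h2 := ltn_ord w.1.2; have h3 := ltn_ord w.2.
    apply: leq_trans (leq_add h1 (leqnn _)) _; clear -h2 h3; case: w h2 h3 => [[k j] a] /=; lia.
  rewrite -[RHS](horner0 x) -C0 /C /u !horner_sum linear_sum horner_sum mulr_sumr /=.
  apply: eq_bigr => w _; rewrite nderivnZ !hornerZ hornerM horner_exp hornerXsubC.
  have := congr1 (horner^~ x) (hasse_quotP l w.1.1 w.2).
  rewrite /= !hornerM horner_exp (kummer_mon_horner _ xb xy) => E.
  by rewrite mulrCA -E; ring.
have sR : (size R <= A + q * D.-1)%N.
  apply: leq_trans (size_sum _ _ _) _; apply/bigmax_leqP => [[[k j] a]] _ /=.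
  have [->|rw] := eqVneq (rho (k, j, a)) 0; first by rewrite scale0r size_poly0.
  have wU : (k, j, a) \in U by apply: contraR rw => /rhoU ->.
  apply: leq_trans (size_scale_leq _ _) _.
  apply: leq_trans (size_polyMleq _ _) _.
  have h1 := size_poly_exp_leq p j; rewrite sp /= in h1.
  have h2 : (size ('X^a * g k)%R <= a + (c * kummer_deg e n k).+1)%N.
    apply: leq_trans (size_polyMleq _ _) _; rewrite size_polyXn /= size_prod_XsubC_exp.
    by rewrite -big_distrr.
  have h3 := ltn_ord a.
  have h4 : (c * kummer_deg e n k <= q.-1 * kummer_ceil e n k)%N.
    by rewrite -cn -mulnA leq_mul2l kummer_deg_ceil ?orbT // ltnW.
  have h5 : (q * (j + kummer_ceil e n k) <= q * D.-1)%N.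
    by rewrite leq_mul2l; apply/orP; right; move: wU; rewrite inE /=; lia.
  have h6 : (q.-1 * kummer_ceil e n k <= q * kummer_ceil e n k)%N.
    by rewrite leq_mul2r leq_pred orbT.
  rewrite mulnDr in h5.
  apply: leq_trans (_ : (a + (c * kummer_deg e n k).+1 + (q * j).+1).-1 <= _)%N; last lia.
  by rewrite -!subn1 leq_sub2r // leq_add.
apply: leq_trans sR; have -> : (#|Z| * M)%N = (size (\prod_(x in Z) ('X - x%:P) ^+ M)).-1.
  rewrite size_prod; last by move=> x _; rewrite expf_neq0 // polyXsubC_eq0.
  under eq_bigr => x _ do rewrite size_exp_XsubC -addn1.
  by rewrite big_split /= sum_nat_const sum1_card -addSn addnK.
apply: leq_trans (leq_pred _) _; apply: dvdp_leq => //.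
rewrite -big_enum; apply: prod_dvdp; first exact: enum_uniq.
  by move=> x x' xx'; apply: coprimep_XsubC_exp.
by move=> x; rewrite mem_enum; apply: Rdvd.
Qed.
End Stepanov.

(** * Numerical parameters *)

(** Here s is the integer part of the square root of q, and also the order M of
vanishing in [stepanov_count]. Then A is about q / n and n D about s + kap, where kap
is about half of (n - 1) (m - 1) + n (m - 1): the first summand pays for the degrees
of the monomials g_k, the second for the growth of the degrees of the linear
conditions with the order of derivation. *)
Lemma stepanov_parameters (q s d n m : nat) :
  (8 <= d)%N -> (2 <= n <= d)%N -> (0 < m < 2 * d)%N -> (s * s <= q <= s * s + 2 * s)%N ->
  (d ^ 6 <= s)%N ->
  exists A D : nat, [/\ (n * A + 2 * m * n ^ 2 < q)%N, (0 < D)%N,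
    (2 * (s * (A + D)) + m.-1 * (s * s.-1) + A * (n.-1 * m.+1) < A * (2 * (n * D)))%N &
    forall N, (N * s <= A + q * D.-1)%N -> (n * N + m <= q + 2 * d ^ 2 * s)%N].
Proof.
move=> d8 /andP[n2 nd] /andP[m0 md] /andP[q1 q2] s6.
have n0 : (0 < n)%N by apply: ltnW.
have d2 : (d ^ 2 = d * d)%N by rewrite expnS expn1.
have n22 : (n ^ 2 = n * n)%N by rewrite expnS expn1.
have d6 : (d ^ 6 = d * d * (d * d) * (d * d))%N by rewrite !expnS expn0 muln1 !mulnA.
rewrite d6 in s6; rewrite d2 n22; clear d2 n22 d6.
have [y Ey] : exists y, y = (d * d)%N by exists (d * d)%N.
rewrite -Ey in s6 *.
have y8 : (8 * d <= y)%N by rewrite Ey leq_mul2r d8 orbT.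
have y64 : (64 <= y)%N by clear -y8 d8; lia.
have [m1 Em] : exists m1, m = m1.+1 by exists m.-1; rewrite prednK.
subst m; clear m0.
have nm1 : (n * m1 + 2 * d <= 2 * y)%N.
  have h : (n * m1 <= d * (2 * d - 2))%N by apply: leq_mul => //; clear -md; lia.
  by apply: leq_trans (leq_add h (leqnn _)) _; rewrite Ey; clear -d8; nia.
(* The summand 3, rather than 2, absorbs the lower order terms. *)
have [kap kap1] : exists kap,
   ((2 * n - 1) * m1 + 3 <= 2 * kap <= (2 * n - 1) * m1 + 4)%N.
  exists (((2 * n - 1) * m1 + 4) %/ 2)%N; move: ((2 * n - 1) * m1)%N => u; clear.
  have := divn_eq (u + 4) 2; have := ltn_pmod (u + 4) (ltn0Sn 1); lia.
have kap2 : (kap + n + 2 * d <= 2 * y + 3)%N.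
  have h : ((2 * n - 1) * m1 <= (2 * d - 1) * (2 * d - 2))%N.
    by apply: leq_mul; clear -md nd; lia.
  have : ((2 * d - 1) * (2 * d - 2) + 6 * d = 4 * y + 2)%N by rewrite Ey; clear -d8; nia.
  move: h kap1; move: ((2 * n - 1) * m1)%N ((2 * d - 1) * (2 * d - 2))%N => u v.
  clear -nd; lia.
have mn : (m1.+1 * n <= 2 * y)%N by rewrite mulnC mulnS; clear -nm1 nd; lia.
have mnn : (m1.+1 * n * n <= 2 * y * d)%N by apply: leq_mul.
have yd : (8 * (y * d) <= y * y)%N by rewrite mulnCA leq_mul2l y8 orbT.
have yy : (64 * y <= y * y)%N by rewrite leq_mul2r y64 orbT.
have yyy : (64 * (y * y) <= y * y * y)%N by rewrite mulnC leq_mul2l y64 orbT.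
have ss : (y * y * y * s <= s * s)%N by rewrite leq_mul2r s6 orbT.
have s1 : (64 * (y * y) <= s)%N by clear -yyy s6; lia.
have ss1 : (64 * (y * y) * s <= s * s)%N by rewrite leq_mul2r s1 orbT.
have yys : (64 * (y * s) <= y * y * s)%N by rewrite mulnA leq_mul2r yy orbT.
have h0 : (4 * (y * d) < s)%N by clear -yd s1 yy y64; lia.
have q0 : (s <= q)%N by apply: leq_trans q1; rewrite leq_pmulr //; clear -s1 y64; nia.
have [A [Aq A0]] : exists A, (q <= n * A + 2 * (m1.+1 * n * n) + n)%N /\
     (n * A + 2 * (m1.+1 * n * n) < q)%N.
  exists (q.-1 %/ n - 2 * m1.+1 * n)%N.
  have h1 := divn_eq q.-1 n; have h2 := ltn_pmod q.-1 n0.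
  have h3 : (2 * m1.+1 * n <= q.-1 %/ n)%N.
    rewrite leq_divRL // -2!mulnA [(m1.+1 * _)%N]mulnA; clear -mnn h0 q0; lia.
  have h4 : (n * (q.-1 %/ n - 2 * m1.+1 * n) = q.-1 %/ n * n - 2 * (m1.+1 * n * n))%N.
    by rewrite mulnBr mulnC; congr (_ - _)%N; rewrite mulnC !mulnA.
  have h5 : (2 * (m1.+1 * n * n) <= q.-1 %/ n * n)%N.
    by rewrite !mulnA leq_mul2r h3 orbT.
  rewrite h4; clear -h1 h2 h5 h0 q0; lia.
have [D /andP[D1 D2]] : exists D, (s + kap + n - 1 <= n * D <= s + kap + 2 * n - 2)%N.
  exists ((s + kap + 2 * n - 2) %/ n)%N; rewrite mulnC.
  have := divn_eq (s + kap + 2 * n - 2) n; have := ltn_pmod (s + kap + 2 * n - 2) n0.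
  move: (_ %/ _ * _)%N (_ %% _)%N => u v; clear -n2; lia.
have D0 : (0 < D)%N.
  by case: D D1 {D2} => //; rewrite muln0; clear -n2 h0; lia.
pose L := (2 * (m1.+1 * n * n) + n)%N.
have LE : (L <= y * y)%N.
  rewrite /L; clear -mnn yd y8 nd yy y64; lia.
exists A, D; split => //.
- by have -> : (2 * m1.+1 * (n * n) = 2 * (m1.+1 * n * n))%N by rewrite !mulnA.
- rewrite -(ltn_pmul2l n0) /=.
  have [n' En] : exists n', n = n'.+1 by exists n.-1; rewrite prednK.
  have E1 : (n.-1 * m1.+2 + 2 * s + (n * m1 + 3) <= 2 * (n * D))%N.
    apply: leq_trans (_ : 2 * (s + kap + n - 1) <= _)%N; last by rewrite leq_mul2l D1.
    have E2 : (n.-1 * m1.+2 = n * m1 - m1 + 2 * n - 2)%N by rewrite En /=; clear; nia.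
    have E3 : ((2 * n - 1) * m1 = 2 * (n * m1) - m1)%N by rewrite mulnBl mul1n mulnA.
    have E4 : (m1 <= n * m1)%N by rewrite leq_pmull.
    rewrite E2; rewrite E3 in kap1; clear -kap1 E4 n2; lia.
  set a := (n * A)%N in Aq A0.
  have E5 : (a * (n.-1 * m1.+2 + 2 * s + (n * m1 + 3)) <= a * (2 * (n * D)))%N.
    by rewrite leq_mul2l E1 orbT.
  have E6 : (2 * s * (n * D) + n * m1 * (s * s.-1) < a * (n * m1 + 3))%N.
    move: nm1 D2 kap2; move: (n * m1)%N (n * D)%N => p w nm1 D2 kap2.
    have aL : (s * s <= a + y * y)%N by clear -Aq LE q1; rewrite /L in LE; lia.
    have p3 : (p + 3 <= 3 * y)%N by clear -nm1 y64; lia.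
    have h1 : (s * s * (p + 3) <= (a + y * y) * (p + 3))%N by rewrite leq_mul2r aL orbT.
    have h2 : (y * y * (p + 3) <= 3 * s)%N.
      apply: leq_trans (leq_mul (leqnn _) p3) _.
      by rewrite mulnCA leq_mul2l /=.
    have h3 : (2 * s * w <= 2 * (s * s) + 6 * (y * s))%N.
      have : (2 * s * w <= 2 * s * (s + 3 * y))%N.
        rewrite leq_mul2l; apply/orP; right; clear -D2 kap2 nd y8 y64; lia.
      clear; nia.
    have h4 : (p * (s * s.-1) <= s * s * p)%N by rewrite mulnC leq_mul2r leq_mul2l leq_pred !orbT.
    have h5 : (6 * (y * s) + 3 * s < s * s)%N.
      have : (y * s <= s * s - 64 * (y * s))%N by clear -yys ss1 ; lia.
      have : (64 * s <= y * s)%N by rewrite leq_mul2r y64 orbT.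
      have : (0 < s)%N by clear -h0; lia.
      clear; lia.
    rewrite !mulnDl !mulnDr in h1; rewrite mulnDr in h2; rewrite mulnDr; clear -h1 h2 h3 h4 h5; lia.
  have -> : (n * (2 * (s * (A + D)) + m1 * (s * s.-1) + A * (n.-1 * m1.+2)) =
      2 * s * (n * D) + n * m1 * (s * s.-1) + (a * (n.-1 * m1.+2) + a * (2 * s)))%N.
    rewrite /a; move: (n.-1) (s.-1) => n1 s2; clear; nia.
  have -> : (n * (A * (2 * (n * D))) = a * (2 * (n * D)))%N by rewrite mulnA.
  apply: leq_trans E5; rewrite !mulnDr; rewrite !mulnDr in E6.
  clear -E6; lia.
- move=> N HN; rewrite addnS.
  have h1 : (n * (N * s) <= n * A + q * (n * D.-1))%N.
    by rewrite [(q * (n * _))%N]mulnCA -mulnDr leq_mul2l HN orbT.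
  have h2 : (n * D.-1 + n <= s + kap + 2 * n - 2)%N by rewrite addnC -mulnS prednK.
  have h3 : (n * N * s <= q * (s + kap + n - 1))%N.
    rewrite -mulnA; apply: leq_trans h1 _.
    apply: leq_trans (_ : q * (n * D.-1 + 1) <= _)%N.
      by rewrite mulnDr muln1 addnC leq_add2l; clear -A0; lia.
    by rewrite leq_mul2l; apply/orP; right; clear -h2 n2; lia.
  have h4 : (q * (s + kap + n - 1) <= (q + (s + 2) * (kap + n - 1)) * s)%N.
    have -> : (s + kap + n - 1 = s + (kap + n - 1))%N by clear -n2; lia.
    rewrite mulnDr mulnDl leq_add2l mulnAC leq_mul2r; apply/orP; right; clear -q2; nia.
  have h5 : (n * N <= q + (s + 2) * (kap + n - 1))%N.
    by rewrite -(leq_pmul2r (_ : 0 < s)%N) ?(leq_trans h3) //; clear -h0; lia.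
  have h6 : (kap + n - 1 <= 2 * y + 2 - 2 * d)%N by clear -kap2; lia.
  have h7 : ((s + 2) * (kap + n - 1) <= (s + 2) * (2 * y + 2 - 2 * d))%N by rewrite leq_mul2l h6 orbT.
  have h8 : ((s + 2) * (2 * y + 2 - 2 * d) + m1 + 1 <= 2 * y * s)%N.
    have : (2 * y + 2 - 2 * d + 14 <= 2 * y)%N by clear -d8 y8; lia.
    move: (2 * y + 2 - 2 * d)%N => z hz.
    have h : ((s + 2) * (z + 14) <= (s + 2) * (2 * y))%N by rewrite leq_mul2l hz orbT.
    rewrite mulnDr [((s + 2) * (2 * y))%N]mulnDl [(s * _)%N]mulnC in h.
    clear -h md y8 s1 yy y64; lia.
  clear -h5 h7 h8; lia.
Qed.

(** * From cell counts to character sums *)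

Lemma kummer_cell_bound (K : finFieldType) m (b : 'I_m -> K) (e : 'I_m -> nat)
    (n c d s : nat) (y : K) :
  injective b -> (forall i, (e i < n)%N) -> (c * n)%N = #|K|.-1 ->
  (forall s, (forall i, n %| s * e i)%N -> (n %| s)%N) ->
  (8 <= d)%N -> (2 <= n <= d)%N -> (0 < m < 2 * d)%N ->
  (s * s <= #|K| <= s * s + 2 * s)%N -> (d ^ 6 <= s)%N ->
  (n * #|[set x : K | [forall i, x != b i] && (\prod_i (x - b i) ^+ (c * e i) == y)%R]| + m
     <= #|K| + 2 * d ^ 2 * s)%N.
Proof.
move=> b_inj e_lt cn e_prim d8 nd md sq s6.
have [A [D [small D0 count concl]]] := stepanov_parameters d8 nd md sq s6.
have [/andP[n2 _] /andP[m0 _] /andP[s1 _]] := And3 nd md sq.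
apply/concl/(stepanov_count b_inj e_lt n2 cn m0 e_prim) => //.
  have [->//|s0] := posnP s; apply: leq_trans s1; by rewrite leq_pmulr.
have h1 : (n * D <= \sum_(k < n) (D - kummer_ceil e n k) + \sum_(k < n) kummer_ceil e n k)%N.
  rewrite -big_split /= -[X in (X * _ <= _)%N]card_ord -sum_nat_const.
  by apply: leq_sum => k _; rewrite addnC -leq_subLR.
have h2 := kummer_ceil_sum e n2.
have h3 : (2 * 'C(s, 2) = s * s.-1)%N by rewrite -[2%N]/(1.+1) -mul_bin_diag bin1.
move: h1 h2; move: (\sum_(k < n) (D - kummer_ceil e n k))%N (\sum_(k < n) kummer_ceil e n k)%N => u v h1 h2.
have h4 : (A * (2 * (n * D)) <= A * (2 * u + n.-1 * m.+1))%N.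
  by rewrite leq_mul2l; apply/orP; right; lia.
rewrite -(ltn_pmul2l (_ : 0 < 2)%N) // mulnDr [(2 * (m.-1 * _))%N]mulnCA h3.
rewrite [(2 * (A * u))%N]mulnCA; rewrite mulnDr in h4; lia.
Qed.

Lemma norm_prim_root (xi : algC) n : n.-primitive_root xi -> `|xi| = 1.
Proof.
move=> xip; have n0 := prim_order_gt0 xip.
by apply/eqP; rewrite -(pexpr_eq1 n0) // -normrX (prim_expr_order xip) normr1.
Qed.

(** Since the powers of xi have sum zero, the numbers N_j of x with [f x] congruent to
j may be replaced by N_j - M, where M is the largest of them; these all have the same
sign, so that an upper bound for M controls the sum of their absolute values. *)
Lemma char_sum_le (T : finType) (X : {set T}) (f : T -> nat) n (xi : algC) (B : nat) :
  n.-primitive_root xi -> (1 < n)%N ->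
  (forall j, (j < n)%N -> (n * #|[set x in X | (f x %% n == j)%N]| <= #|X| + B)%N) ->
  `|\sum_(x in X) xi ^+ f x| <= B%:R.
Proof.
move=> xip n1 H.
have n0 : (0 < n)%N by apply: ltnW.
pose N (j : 'I_n) := #|[set x in X | (f x %% n == j)%N]|.
pose M := \max_(j < n) N j.
have sum0 : \sum_(j < n) xi ^+ j = 0.
  have xi1 : xi != 1.
    apply: contraTneq n1 => x1; rewrite -leqNgt dvdn_leq // (prim_order_dvd xip) x1.
    by rewrite expr1n.
  have := subrX1 xi n; rewrite (prim_expr_order xip) subrr => /esym/eqP.
  by rewrite mulf_eq0 subr_eq0 (negbTE xi1) /= => /eqP.
have SE : \sum_(x in X) xi ^+ f x = \sum_(j < n) (N j)%:R * xi ^+ j.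
  rewrite (partition_big (fun x => Ordinal (ltn_pmod (f x) n0)) xpredT) //=.
  apply: eq_bigr => j _; rewrite /N -sum1_card natr_sum mulr_suml.
  apply: eq_big => [x|x /andP[_ /eqP Ej]]; first by rewrite inE -val_eqE.
  by rewrite mul1r -(prim_expr_mod xip) -Ej.
have cardX : (\sum_(j < n) N j = #|X|)%N.
  rewrite -sum1_card (partition_big (fun x => Ordinal (ltn_pmod (f x) n0)) xpredT) //=.
  apply: eq_bigr => j _; rewrite /N -sum1_card.
  by apply: eq_bigl => x; rewrite inE -val_eqE.
have NM j : (N j <= M)%N by rewrite /M (leq_bigmax j).
have -> : \sum_(x in X) xi ^+ f x = - \sum_(j < n) (M%:R * xi ^+ j - (N j)%:R * xi ^+ j).
  by rewrite sumrB -mulr_sumr sum0 mulr0 sub0r opprK.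
rewrite normrN.
apply: le_trans (ler_norm_sum _ _ _) _.
have -> : \sum_(j < n) `|M%:R * xi ^+ j - (N j)%:R * xi ^+ j| = (\sum_(j < n) (M - N j))%N%:R.
  rewrite natr_sum; apply: eq_bigr => j _; rewrite -mulrBl normrM normrX.
  by rewrite (norm_prim_root xip) expr1n mulr1 -natrB // normr_nat.
rewrite ler_nat.
have : (\sum_(j < n) (M - N j) + \sum_(j < n) N j = n * M)%N.
  rewrite -big_split /= -[X in (_ = X * _)%N]card_ord -sum_nat_const.
  by apply: eq_bigr => j _; rewrite subnK.
rewrite cardX => E.
have [j Mj] : exists j, M = N j.
  by have [|j Ej] := @bigop.eq_bigmax _ N; [rewrite card_ord | exists j].
by have := H j (ltn_ord j); rewrite -/(N j) -Mj -E addnC leq_add2l.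
Qed.

Lemma sqr_sum_nat_le (I : finType) (A : {set I}) (F : I -> nat) :
  ((\sum_(i in A) F i) ^ 2 <= #|A| * \sum_(i in A) F i ^ 2)%N.
Proof.
rewrite -(leq_pmul2l (_ : 0 < 2)%N) //.
have -> : (2 * (\sum_(i in A) F i) ^ 2 = \sum_(i in A) \sum_(j in A) 2 * (F i * F j))%N.
  rewrite -mulnn big_distrl big_distrr /=; apply: eq_bigr => i _.
  by rewrite !big_distrr.
apply: (@leq_trans (\sum_(i in A) \sum_(j in A) (F i ^ 2 + F j ^ 2))%N).
  by apply: leq_sum => i _; apply: leq_sum => j _; rewrite nat_Cauchy.
under eq_bigr => i _ do rewrite big_split /= sum_nat_const.
by rewrite big_split /= -big_distrr /= sum_nat_const addnn mul2n.
Qed.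

(** Orthogonality of the characters of a cyclic group of order d. *)
Lemma sum_prim_root_pow (om : algC) d (a b : 'I_d) : d.-primitive_root om ->
  \sum_(k < d) om ^+ (k * a) * (om ^+ (k * b))^* = if a == b then d%:R else 0.
Proof.
move=> omp; have d0 := prim_order_gt0 omp.
have nrm := norm_prim_root omp.
have E (k : nat) : om ^+ (k * a) * (om ^+ (k * b))^* = (om ^+ a * (om ^+ b)^*) ^+ k.
  by rewrite exprMn -rmorphXn -!exprM ![(k * _)%N]mulnC.
under eq_bigr => k _ do rewrite E.
have conjE : (om ^+ b)^* * om ^+ b = 1.
  by rewrite mulrC -normCK normrX nrm !expr1n.
have [->|ab] := eqVneq a b.
  under eq_bigr => k _ do rewrite mulrC conjE expr1n.
  by rewrite sumr_const card_ord.
set x := _ * _; have x1 : x != 1.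
  apply: contra ab => /eqP xx; have : x * om ^+ b = om ^+ b by rewrite xx mul1r.
  rewrite /x -mulrA conjE mulr1 => /eqP.
  by rewrite (eq_prim_root_expr omp) !modn_small // => /eqP/val_inj->.
have := subrX1 x d; rewrite exprMn -rmorphXn -!exprM ![(_ * d)%N]mulnC !exprM.
rewrite (prim_expr_order omp) !expr1n rmorph1 mulr1 subrr => /esym/eqP.
by rewrite mulf_eq0 subr_eq0 (negbTE x1) /= => /eqP.
Qed.

(** If the cells in [Om] contain no point of [X], the points are spread over fewer
cells than they would be in a uniform distribution, and so the sum of the squares of
the cell counts exceeds its least value; by Parseval's identity this excess is an
average of squares of character sums. *)
Lemma empty_cells_le (T : finType) (X : {set T}) (m d B : nat) (om : algC)
    (phi : T -> {ffun 'I_m -> 'I_d}) (Om : {set {ffun 'I_m -> 'I_d}}) :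
  d.-primitive_root om ->
  (forall e : {ffun 'I_m -> 'I_d}, (exists i, e i != 0%N :> nat) ->
     `|\sum_(x in X) om ^+ (\sum_i e i * phi x i)| <= B%:R) ->
  (forall x, x \in X -> phi x \notin Om) ->
  (#|Om| * #|X| ^ 2 <= d ^ (2 * m) * B ^ 2)%N.
Proof.
move=> omp HB Xom; have d0 := prim_order_gt0 omp.
pose S (e : {ffun 'I_m -> 'I_d}) := \sum_(x in X) om ^+ (\sum_i e i * phi x i).
pose N w := #|[set x in X | phi x == w]|.
have Parseval : \sum_e `|S e| ^+ 2 = (d ^ m * \sum_w N w ^ 2)%N%:R.
  have E e : `|S e| ^+ 2 = \sum_(x in X) \sum_(y in X)
      \prod_i (om ^+ (e i * phi x i) * (om ^+ (e i * phi y i))^*).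
    rewrite normCK /S rmorph_sum mulr_suml; apply: eq_bigr => x _.
    rewrite mulr_sumr; apply: eq_bigr => y _.
    rewrite big_split /= -rmorph_prod /=; congr (_ * (_)^*).
      by elim/big_rec2: _ => [|i u v _ <-]; rewrite ?expr0 ?exprD.
    by elim/big_rec2: _ => [|i u v _ <-]; rewrite ?expr0 ?exprD.
  rewrite (eq_bigr _ (fun e _ => E e)) exchange_big /=.
  under eq_bigr => x _.
    rewrite exchange_big /=.
    under eq_bigr => y _.
      rewrite -(bigA_distr_bigA (fun i (k : 'I_d) => om ^+ (k * phi x i) * (om ^+ (k * phi y i))^*)).
      under eq_bigr => i _ do rewrite sum_prim_root_pow //.
      have -> : \prod_i (if phi x i == phi y i then d%:R else 0) =
        (if phi y == phi x then (d ^ m)%N%:R else 0 : algC).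
        case: (eqVneq (phi y) (phi x)) => [->|ne].
          under eq_bigr => i _ do rewrite eqxx.
          by rewrite prodr_const card_ord natrX.
        have [i ni] : exists i, phi x i != phi y i.
          apply/existsP; apply: contraNT ne => /existsPn H; apply/eqP/ffunP => i.
          by have := H i; rewrite negbK => /eqP.
        by rewrite (bigD1 i) //= (negbTE ni) mul0r.
      over.
    rewrite -big_mkcondr /= sumr_const.
    over.
  rewrite natrM natr_sum mulr_sumr.
  rewrite (partition_big phi xpredT) //=; apply: eq_bigr => w _.
  rewrite (eq_bigr (fun _ => (d ^ m)%N%:R *+ N w)); last first.
    move=> x /andP[_ /eqP Ex]; congr (_ *+ _); rewrite /N; apply: eq_card => y.
    by rewrite !inE Ex.
  rewrite sumr_const -mulrnA -[LHS]mulr_natr -mulnn; congr (_ * (_ * _)%N%:R).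
  by apply: eq_card => y; rewrite !inE.
have card_fun : #|{ffun 'I_m -> 'I_d}| = (d ^ m)%N by rewrite card_ffun !card_ord.
pose e0 : {ffun 'I_m -> 'I_d} := [ffun=> Ordinal d0].
have le1 : (d ^ m * \sum_w N w ^ 2 <= #|X| ^ 2 + d ^ m * B ^ 2)%N.
  rewrite -(ler_nat algC) -Parseval (bigD1 e0) //= natrD; apply: lerD.
    rewrite /S (eq_bigr (fun _ => 1)); last first.
      move=> x _; rewrite big1 ?expr0 // => i _; rewrite ffunE mul0n //.
    by rewrite sumr_const normr_nat natrX.
  apply: (@le_trans _ _ (\sum_(e | e != e0) (B ^ 2)%N%:R)).
    apply: ler_sum => e en; rewrite natrX lerXn2r ?nnegrE ?normr_ge0 ?ler0n //.
    apply: HB; apply/existsP; apply: contraNT en => /existsPn H; apply/eqP/ffunP => i.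
    by apply: val_inj; rewrite ffunE /=; have := H i; rewrite negbK => /eqP.
  rewrite -natr_sum ler_nat sum_nat_const -card_fun leq_mul2r.
  by rewrite (leq_trans (max_card _)) ?orbT.
have le2 : (#|X| ^ 2 <= #|~: Om| * \sum_w N w ^ 2)%N.
  have -> : #|X| = (\sum_(w in ~: Om) N w)%N.
    rewrite -sum1_card (partition_big phi (mem (~: Om))) /=; last first.
      by move=> x xX; rewrite inE Xom.
    apply: eq_bigr => w _; rewrite /N -sum1_card; apply: eq_bigl => x; by rewrite inE.
  apply: leq_trans (sqr_sum_nat_le _ _) _; rewrite leq_mul2l; apply/orP; right.
  by rewrite [X in (_ <= X)%N](bigID (mem (~: Om))) /= leq_addr.
have cc : (#|Om| + #|~: Om| = d ^ m)%N by rewrite cardsC card_fun.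
rewrite mul2n -addnn expnD; move: le1 le2 cc.
move: (d ^ m)%N (\sum_w N w ^ 2)%N (#|X| ^ 2)%N (B ^ 2)%N #|Om| #|~: Om| => h S2 X2 B2 g k.
clear => le1 le2 cc.
have h1 : (h * X2 <= k * (h * S2))%N by rewrite mulnCA leq_mul2l le2 orbT.
have h2 : (k * (h * S2) <= k * X2 + k * (h * B2))%N by rewrite -mulnDr leq_mul2l le1 orbT.
have h3 : (k * (h * B2) <= h * h * B2)%N by rewrite -mulnA leq_mul2r -cc leq_addl orbT.
rewrite -cc mulnDl in h1; rewrite cc in h1; lia.
Qed.

(** * Elements with prescribed labels *)

(** A character of order n can be written with exponents modulo n whose common divisor
with n is 1; this last property is what the independence of the Kummer monomials
requires. *)
Lemma common_divisor_reduction m d (e : 'I_m -> nat) : (forall i, (e i < d)%N) ->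
  (exists i, e i != 0%N) ->
  exists t n (e' : 'I_m -> nat), [/\ d = (t * n)%N, (1 < n)%N, forall i, e i = (t * e' i)%N,
    forall i, (e' i < n)%N & forall s, (forall i, n %| s * e' i)%N -> (n %| s)%N].
Proof.
move=> ed [i0 ei0].
have d0 : (0 < d)%N by apply: leq_ltn_trans (ed i0).
pose t := gcdn d (\big[gcdn/0%N]_i e i).
have t0 : (0 < t)%N by rewrite gcdn_gt0 d0.
have td : (t %| d)%N by rewrite dvdn_gcdl.
have te i : (t %| e i)%N.
  apply: dvdn_trans (dvdn_gcdr _ _) _; rewrite (bigD1 i) //=; exact: dvdn_gcdl.
exists t, (d %/ t)%N, (fun i => (e i %/ t)%N); split.
- by rewrite mulnC divnK.
- rewrite ltn_divRL // mul1n; apply: leq_ltn_trans (ed i0).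
  by apply: dvdn_leq (te i0); rewrite lt0n.
- by move=> i; rewrite mulnC divnK.
- by move=> i; rewrite ltn_divRL // divnK.
move=> s H.
have : (d %| s * t)%N.
  rewrite /t muln_gcdr dvdn_gcd dvdn_mull //=.
  elim/big_rec: _ => [|i x _ IH]; first by rewrite muln0 dvdn0.
  rewrite muln_gcdr dvdn_gcd IH andbT.
  by have := H i; rewrite -(dvdn_pmul2r t0) divnK // -mulnA divnK.
by rewrite -{1}(divnK td) dvdn_pmul2r.
Qed.

(** Stepanov's bound, applied to the order of every nontrivial character, contradicts
[empty_cells_le] when [Om] is large. *)
Lemma exists_in_cells (K : finFieldType) (d c s m : nat) (z : K) (b : 'I_m -> K)
    (Om : {set {ffun 'I_m -> 'I_d}}) :
  (8 <= d)%N -> (c * d)%N = #|K|.-1 -> d.-primitive_root z -> injective b ->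
  (0 < m < 2 * d)%N -> (s * s <= #|K| <= s * s + 2 * s)%N -> (d ^ 6 <= s)%N ->
  (d ^ (2 * m) * (2 * d ^ 2 * s) ^ 2 < #|Om| * (#|K| - m) ^ 2)%N ->
  exists x rho, rho \in Om /\ forall i, (x - b i) ^+ c = z ^+ rho i.
Proof.
move=> d8 cd zp binj md sq s6 big.
have d0 : (0 < d)%N by apply: leq_trans d8.
have q0 : (0 < #|K|)%N by apply/card_gt0P; exists 0.
have exp1 (x : K) : x != 0 -> x ^+ #|K|.-1 = 1.
  by move=> x0; apply: (mulfI x0); rewrite -exprS prednK // expf_card mulr1.
have [om omp] := C_prim_root_exists d0.
(* The discrete logarithm of the label. *)
pose lg (x : K) : 'I_d := odflt (Ordinal d0) [pick k : 'I_d | x ^+ c == z ^+ k].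
have lgP x : x != 0 -> x ^+ c = z ^+ lg x.
  move=> x0; rewrite /lg; case: pickP => [k /eqP //|/= none].
  have : (x ^+ c) ^+ d = 1 by rewrite -exprM cd exp1.
  by move/(prim_rootP zp) => [k Ek]; have := none k; rewrite Ek eqxx.
pose X := [set x : K | [forall i, x != b i]].
pose phi (x : K) : {ffun 'I_m -> 'I_d} := [ffun i => lg (x - b i)].
have phiP x i : x \in X -> (x - b i) ^+ c = z ^+ phi x i.
  by rewrite inE => /forallP/(_ i) xb; rewrite ffunE -lgP // subr_eq0.
have cardX : (#|X| + m = #|K|)%N.
  rewrite -(cardC X); congr (_ + _)%N; rewrite -[LHS]card_ord -(card_codom binj).
  apply: eq_card => x; rewrite !inE; apply/idP/idP.
    by move/codomP => [i ->]; apply/negP => /forallP/(_ i); rewrite eqxx.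
  by rewrite negb_forall => /existsP[i]; rewrite negbK => /eqP->; apply: codom_f.
have bound (e : {ffun 'I_m -> 'I_d}) : (exists i, e i != 0%N :> nat) ->
     `|\sum_(x in X) om ^+ (\sum_i e i * phi x i)| <= (2 * d ^ 2 * s)%N%:R.
  move=> en; have [t [n [e' [Ed n1 Ee e'n prim]]]] := common_divisor_reduction (fun i => ltn_ord (e i)) en.
  have /andP[t0 n0] : (0 < t)%N && (0 < n)%N by rewrite -muln_gt0 -Ed.
  have omt : n.-primitive_root (om ^+ t).
    rewrite -(_ : (d %/ gcdn t d)%N = n); first exact: exp_prim_root.
    by rewrite Ed (gcdn_idPl _) ?dvdn_mulr // mulKn.
  have E x : om ^+ (\sum_i e i * phi x i) = (om ^+ t) ^+ (\sum_i e' i * phi x i).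
    by rewrite -exprM big_distrr /=; congr (_ ^+ _); apply: eq_bigr => i _; rewrite mulnA -Ee.
  under eq_bigr => x _ do rewrite E.
  apply: (char_sum_le omt n1) => j jn.
  have ctn : (c * t * n)%N = #|K|.-1 by rewrite -mulnA -Ed.
  have nd : (2 <= n <= d)%N by rewrite n1 /= Ed leq_pmull.
  have := kummer_cell_bound ((z ^+ t) ^+ j) binj e'n ctn prim d8 nd md sq s6.
  rewrite -cardX addnAC leq_add2r; apply: leq_trans; rewrite leq_mul2l; apply/orP; right.
  apply: subset_leq_card; apply/subsetP => x; rewrite 3!inE => /andP[xb /eqP xj].
  rewrite xb /=; apply/eqP.
  have ztn : n.-primitive_root (z ^+ t).
    rewrite -(_ : (d %/ gcdn t d)%N = n); first exact: exp_prim_root.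
    by rewrite Ed (gcdn_idPl _) ?dvdn_mulr // mulKn.
  rewrite -[in RHS]xj (prim_expr_mod ztn) -exprM big_distrr /= -prodrXr.
  apply: eq_bigr => i _.
  have xX : x \in X by rewrite inE.
  by rewrite -mulnA exprM phiP // -exprM; congr (_ ^+ _); rewrite mulnC -mulnA.
case: (pickP [pred x in X | phi x \in Om]) => [x /= /andP[xX xO]|none].
  by exists x, (phi x); split => // i; apply: phiP.
have := empty_cells_le omp bound.
move=> /(_ Om) h; have {h}: (#|Om| * #|X| ^ 2 <= d ^ (2 * m) * (2 * d ^ 2 * s) ^ 2)%N.
  by apply: h => x xX; apply/negP => xO; have := none x; rewrite /= xX xO.
have -> : #|X| = (#|K| - m)%N by rewrite -cardX addnK.
by rewrite leqNgt big.
Qed.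

(** * Successive choice of the values *)

Lemma exists_isqrt q : exists s, (s * s <= q <= s * s + 2 * s)%N.
Proof.
elim: q => [|q [s /andP[h1 h2]]]; first by exists 0%N.
have [h|h] := ltnP q (s * s + 2 * s); first by exists s; lia.
by exists s.+1; nia.
Qed.

(** The hypothesis on q says that the square root of q is at least (3/2) d^(2 d). The
worst case is n = d - 1, where 2^n (q - m)^2 is to be compared with 4 d^(4 d + 2) s^2;
the factor 2^(d - 1), which is at least 2 d^2 for d at least 8, is what makes the
inequality true. *)
Lemma cell_room d q s n : (8 <= d)%N -> (9 * d ^ (4 * d) <= 4 * q)%N ->
  (s * s <= q <= s * s + 2 * s)%N -> (n < d)%N ->
  (d ^ 6 <= s)%N /\
  (d ^ (2 * (1 + (n + n))) * (2 * d ^ 2 * s) ^ 2 < 2 ^ n * (q - (1 + (n + n))) ^ 2)%N.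
Proof.
move=> d8 q9 /andP[sq1 sq2] nd.
have d1 : (0 < d)%N by apply: leq_trans d8.
have big : (64 * d <= d ^ (4 * d))%N.
  apply: (@leq_trans (d ^ 3)); last by rewrite leq_pexp2l //; lia.
  by rewrite !expnS expn0 muln1 mulnC leq_mul2l (leq_mul d8 d8) orbT.
have D12 : (d ^ 12 <= d ^ (4 * d))%N by rewrite leq_pexp2l //; lia.
split.
  rewrite leqNgt; apply/negP => sd.
  have : ((s + 1) * (s + 1) <= d ^ 12)%N.
    rewrite -[12%N]/(6 + 6)%N expnD; apply: leq_mul; lia.
  move: D12 big q9 sq2 d1; move: (d ^ 12)%N (d ^ (4 * d))%N => u v.
  clear; nia.
have d2 : (2 * d ^ 2 <= 2 ^ d.-1)%N.
  elim: d d8 {sq1 sq2 q9 nd d1 big D12} => // k IH; rewrite leq_eqVlt => /predU1P[<-//|k8].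
  have E : (2 ^ k = 2 * 2 ^ k.-1)%N.
    by rewrite -expnS prednK //; move: k8; clear; lia.
  have := IH k8; rewrite /= E -!mulnn.
  move: (2 ^ k.-1)%N => u h; apply: leq_trans (leq_mul (leqnn 2) h); clear -k8; nia.
have [k Ek] : exists k, (d - 1 = n + k)%N by exists (d - 1 - n)%N; lia.
rewrite -(ltn_pmul2r (_ : 0 < 2 ^ k)%N) ?expn_gt0 // [X in (_ < X)%N]mulnAC -expnD -Ek subn1.
set m := (1 + (n + n))%N.
have e1 : (d ^ (2 * m) * (2 * d ^ 2 * s) ^ 2 * 2 ^ k <= 4 * (d ^ (4 * d) * d ^ 2) * q)%N.
  rewrite expnMn -[((2 * d ^ 2) ^ 2)%N]mulnn -[(s ^ 2)%N]mulnn.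
  apply: (@leq_trans (d ^ (2 * m) * (2 * d ^ 2 * (2 * d ^ 2) * q) * d ^ (4 * k))).
    apply: leq_mul; first by rewrite leq_mul2l leq_mul2l sq1 !orbT.
    apply: (@leq_trans (d ^ k)); last by rewrite leq_pexp2l //; lia.
    case: (posnP k) => [->//|k0]; rewrite leq_exp2r //; move: d8; clear; lia.
  have -> : (d ^ (4 * d) = d ^ (2 * m) * d ^ 2 * d ^ (4 * k))%N.
    by rewrite -!expnD; congr (d ^ _)%N; rewrite /m; move: Ek d1; clear; lia.
  clear; move: (d ^ 2)%N (d ^ (2 * m))%N (d ^ (4 * k))%N => u v w; nia.
have e2 : (2 * d ^ 2 * (q * (q - 2 * m)) <= 2 ^ d.-1 * (q - m) ^ 2)%N.
  apply: leq_mul => //; rewrite -mulnn; clear; nia.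
apply: leq_ltn_trans e1 _; apply: leq_trans e2.
have mm : (2 * m <= 4 * d)%N by rewrite /m; lia.
have -> : (2 * d ^ 2 * (q * (q - 2 * m)) = 2 * d ^ 2 * (q - 2 * m) * q)%N.
  by rewrite [(q * _)%N]mulnC mulnA.
have -> : (4 * (d ^ (4 * d) * d ^ 2) = 2 * d ^ 2 * (2 * d ^ (4 * d)))%N.
  by clear; move: (d ^ 2)%N (d ^ (4 * d))%N => u v; nia.
have q0 : (0 < q)%N by move: big q9 d1; clear; lia.
rewrite ltn_pmul2r // ltn_pmul2l ?muln_gt0 ?expn_gt0 ?d1 //.
move: mm q9 big d8; move: (d ^ (4 * d))%N => u; clear; lia.
Qed.

Section Greedy.
Variables (K : finFieldType) (d c : nat) (z : K).
Hypotheses (d8 : (8 <= d)%N) (cd : (c * d)%N = #|K|.-1) (zp : d.-primitive_root z)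
  (dodd : ~~ odd d) (codd : ~~ odd c) (q9 : (9 * d ^ (4 * d) <= 4 * #|K|)%N).

(** In characteristic 2 the square of z^(d / 2) - 1 would be z^d - 1 = 0, against the
order of z. *)
Lemma two_neq0 : 2%:R != 0 :> K.
Proof.
apply/negP => /eqP t0.
have d0 : (0 < d)%N by apply: leq_trans d8.
have : (z ^+ d./2 - 1) ^+ 2 = 0.
  rewrite sqrrB1 -exprM muln2 halfK (negbTE dodd) subn0 (prim_expr_order zp).
  by rewrite -mulr_natr t0 mulr0 subr0 -[1 + 1]/(2%:R) t0.
move/eqP; rewrite expf_eq0 /= subr_eq0 -(prim_order_dvd zp) => /dvdn_leq.
move: d8; clear; lia.
Qed.

(** The labels of u - v and u + v are the two members of the r-th block of exponents,
in either order. *)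
Definition paired (u v : K) (r : nat) := exists be : bool,
  (u - v) ^+ c = z ^+ (2 * r + be) /\ (u + v) ^+ c = z ^+ (2 * r + ~~ be).

Lemma label_exponent_gt0 : (0 < c)%N.
Proof.
rewrite lt0n; apply: contraTneq q9 => c0; move: cd; rewrite c0 mul0n => h.
have : (#|K| <= 1)%N by case: (#|K|) h => [|[]].
have : (d ^ 1 <= d ^ (4 * d))%N by rewrite leq_pexp2l //; move: d8; clear; lia.
rewrite expn1; move: d8; clear; lia.
Qed.

Lemma neq0_of_label (x : K) k : x ^+ c = z ^+ k -> x != 0.
Proof.
move=> E; have : x ^+ c != 0.
  by rewrite E expf_neq0 // (prim_root_eq0 zp) -lt0n (leq_trans _ d8).
by rewrite expf_eq0 label_exponent_gt0.
Qed.

(** The conditions concern the labels of x, x - a_j and x + a_j, hence the points 0,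
a_j, - a_j; the admissible families of labels correspond to the choices of one order
in each pair, which are 2^n in number. *)
Lemma next_element n (a : 'I_n -> K) (r : 'I_n -> nat) tau : (n < d)%N ->
  (tau < d)%N -> (forall j, 2 * r j + 1 < d)%N ->
  (forall j, a j != 0) -> (forall i j, i != j -> a i != a j /\ a i != - a j) ->
  exists x, x ^+ c = z ^+ tau /\ forall j, paired x (a j) (r j).
Proof.
move=> nd taud rd a0 aij.
have [s sq] := exists_isqrt #|K|.
have [s6 room] := cell_room d8 q9 sq nd.
(* The points 0, a_j and - a_j, indexed in this order. *)
pose b (i : 'I_(1 + (n + n))) : K := match split i with
  | inl _ => 0 | inr k => match split k with inl j => a j | inr j => - a j end end.
have aN j : a j != - a j.
  by rewrite -subr_eq0 opprK -mulr2n -mulr_natr mulf_neq0 ?two_neq0.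
have binj : injective b.
  move=> i i'; rewrite -[i]splitK -[i']splitK /b.
  case: (split i) => [k|k]; case: (split i') => [k'|k']; rewrite !unsplitK.
  - by rewrite !ord1.
  - by case: (split k') => j /esym/eqP; rewrite ?oppr_eq0 (negbTE (a0 _)).
  - by case: (split k) => j /eqP; rewrite ?oppr_eq0 (negbTE (a0 _)).
  rewrite -[k]splitK -[k']splitK.
  case: (split k) => j; case: (split k') => j'; rewrite !unsplitK.
  - have [-> //|/aij[]] := eqVneq j j'; by move=> /eqP.
  - have [->|/aij[_]] := eqVneq j j'; last by move=> /eqP.
    by move/eqP; rewrite (negbTE (aN _)).
  - have [->|/aij[_]] := eqVneq j j'; last by rewrite -eqr_oppLR => /eqP.
    by move/esym/eqP; rewrite (negbTE (aN _)).
  - by move/oppr_inj; have [-> //|/aij[]] := eqVneq j j'; move=> /eqP.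
have lt1 j (be : bool) : (2 * r j + be < d)%N.
  by apply: leq_ltn_trans (rd j); rewrite leq_add2l leq_b1.
pose rho (f : {ffun 'I_n -> bool}) : {ffun 'I_(1 + (n + n)) -> 'I_d} :=
  [ffun i => match split i with inl _ => Ordinal taud | inr k =>
     match split k with inl j => Ordinal (lt1 j (f j)) | inr j => Ordinal (lt1 j (~~ f j)) end end].
pose i1 j : 'I_(1 + (n + n)) := unsplit (inr (unsplit (inl j))).
pose i2 j : 'I_(1 + (n + n)) := unsplit (inr (unsplit (inr j))).
pose i0 : 'I_(1 + (n + n)) := unsplit (inl ord0).
have rhoinj : injective rho.
  move=> f g /ffunP H; apply/ffunP => j; have := congr1 val (H (i1 j)).
  by rewrite !ffunE !unsplitK /= => /addnI; case: (f j); case: (g j).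
have cardOm : #|[set rho f | f : {ffun 'I_n -> bool}]| = (2 ^ n)%N.
  by rewrite card_imset // card_ffun card_bool card_ord.
have [||x [w [/imsetP[f _ ->] H]]] :=
  exists_in_cells d8 cd zp binj _ sq s6 (Om := [set rho f | f : {ffun 'I_n -> bool}]).
- by move: nd; clear; lia.
- by rewrite cardOm.
exists x; split.
  by have := H i0; rewrite /b ffunE !unsplitK subr0.
move=> j; exists (f j); split.
  by have := H (i1 j); rewrite /b ffunE !unsplitK.
by have := H (i2 j); rewrite /b ffunE !unsplitK opprK.
Qed.

Lemma paired_sym u v r : paired u v r -> paired v u r.
Proof.
case=> be [h1 h2]; exists be; split; last by rewrite addrC.
by rewrite -opprB -mulN1r exprMn -signr_odd (negbTE codd) expr0 mul1r.
Qed.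

Lemma paired_neq u v r : paired u v r -> u != v /\ u != - v.
Proof.
by case=> be [/neq0_of_label h1 /neq0_of_label h2]; rewrite -subr_eq0 h1 -addr_eq0 h2.
Qed.

(** Earlier values are nonzero and differ by more than a sign, because their
differences and sums have labels; so [next_element] applies at every step. *)
Lemma greedy_choice (T : eqType) (tau : T -> nat) (r : T -> T -> nat) (l : seq T) :
  (forall t, tau t < d)%N -> (forall t t', r t t' = r t' t) ->
  (forall t t', 2 * r t t' + 1 < d)%N -> uniq l -> (size l <= d)%N ->
  exists a : T -> K, (forall t, t \in l -> a t ^+ c = z ^+ tau t) /\
    forall t t', t \in l -> t' \in l -> t != t' -> paired (a t) (a t') (r t t').
Proof.
move=> taud rsym rd; elim: l => [|t l IH] /=; first by exists (fun=> 0).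
move=> /andP[tl ul] sl; have [a [a1 a2]] := IH ul (ltnW sl).
pose A (j : 'I_(size l)) := a (tnth (in_tuple l) j).
have [|||x [x1 x2]] := @next_element (size l) A (fun j => r t (tnth (in_tuple l) j)) (tau t) sl (taud t).
- by move=> j; apply: rd.
- by move=> j; apply: neq0_of_label (a1 _ _); rewrite mem_tnth.
- move=> i j ij; apply: paired_neq (a2 _ _ _ _ _); rewrite ?mem_tnth //.
  by rewrite !(tnth_nth t) nth_uniq.
have x2' u : u \in l -> paired x (a u) (r t u).
  by move=> /(tnthP (in_tuple l)) [j ->]; apply: x2.
exists (fun u => if u == t then x else a u); split.
  by move=> u; rewrite inE; case: eqP => [->|] //= _; apply: a1.
move=> u v; rewrite !inE; case: eqP => [->|_] /=; case: eqP => [->|_] //=.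
- by rewrite eqxx.
- by move=> _ vl _; apply: x2'.
- by move=> ul' _ _; rewrite rsym; apply/paired_sym/x2'.
exact: a2.
Qed.

End Greedy.

(** * The twin prime power difference set *)

Section QuadraticCharacter.
Variables (F : finFieldType) (h : nat).
Hypothesis cardF : #|F| = (2 * h).+1.

(** The quadratic character, by Euler's criterion. *)
Definition quad_char (x : F) : int := if x == 0 then 0 else if x ^+ h == 1 then 1 else -1.

Lemma half_order_gt0 : (0 < h)%N.
Proof.
rewrite lt0n; apply/eqP => h0; have : (1 < #|F|)%N.
  rewrite (cardD1 0) (cardD1 1) !inE oner_eq0 /=; lia.
by rewrite cardF h0.
Qed.

Lemma pow_half (x : F) : x != 0 -> x ^+ h = 1 \/ x ^+ h = -1.
Proof.
move=> x0; have : (x ^+ h) ^+ 2 = 1.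
  by apply: (mulfI x0); rewrite -exprM mulnC -exprS -cardF expf_card mulr1.
by move/eqP; rewrite sqrf_eq1 => /orP[] /eqP; [left|right].
Qed.

(** The polynomial X^h - 1 has at most h roots. *)
Lemma nonresidue : exists g : F, g != 0 /\ g ^+ h != 1.
Proof.
have [/existsP[g /andP[]]|/existsPn H] := boolP [exists g : F, (g != 0) && (g ^+ h != 1)].
  by exists g.
have pn0 : 'X^h - 1%:P != 0 :> {poly F}.
  by rewrite -size_poly_eq0 size_XnsubC // half_order_gt0.
have allr : all (root ('X^h - 1%:P : {poly F})) (enum [set x : F | x != 0]).
  apply/allP => x; rewrite mem_enum inE => x0.
  by have := H x; rewrite x0 /= negbK rootE !hornerE subr_eq0.
have := max_poly_roots pn0 allr (enum_uniq _).
rewrite size_XnsubC ?half_order_gt0 // -cardE.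
have -> : #|[set x : F | x != 0]| = (2 * h)%N.
  have := cardC (pred1 (0 : F)); rewrite card1 cardF add1n => -[<-].
  by apply: eq_card => x; rewrite !inE.
have := half_order_gt0; lia.
Qed.

Lemma neq_opp1 : (-1 : F) != 1.
Proof.
have [g [g0 g1]] := nonresidue; case: (pow_half g0) => E; first by rewrite E eqxx in g1.
by rewrite -E.
Qed.

Lemma quad_charM x y : quad_char (x * y) = quad_char x * quad_char y.
Proof.
rewrite /quad_char mulf_eq0; case: (eqVneq x 0) => [|x0] /=; first by rewrite mul0r.
case: (eqVneq y 0) => [|y0] /=; first by rewrite mulr0.
rewrite exprMn; have n1 := negbTE neq_opp1.
by case: (pow_half x0) => ->; case: (pow_half y0) => ->;
  rewrite ?mulr1 ?mul1r ?mulrNN ?mulr1 ?eqxx ?n1.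
Qed.

Lemma quad_char0 : quad_char 0 = 0. Proof. by rewrite /quad_char eqxx. Qed.
Lemma quad_char1 : quad_char 1 = 1.
Proof. by rewrite /quad_char oner_eq0 expr1n eqxx. Qed.
Lemma quad_charN1 : quad_char (-1) = (-1) ^+ h.
Proof.
rewrite /quad_char oppr_eq0 oner_eq0 -(signr_odd F) -(signr_odd int).
by case: (odd h); rewrite /= ?expr0 ?expr1 ?eqxx ?(negbTE neq_opp1).
Qed.
Lemma quad_char_sqr x : x != 0 -> quad_char x * quad_char x = 1.
Proof. by move=> x0; rewrite /quad_char (negbTE x0); case: ifP. Qed.
Lemma quad_char_pm x : x != 0 -> quad_char x = 1 \/ quad_char x = -1.
Proof. by move=> x0; rewrite /quad_char (negbTE x0); case: ifP; [left|right]. Qed.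

Lemma quad_char_sum : \sum_x quad_char x = 0.
Proof.
(* Multiplication by a nonresidue changes the sign of the sum. *)
have [g [g0 g1]] := nonresidue.
have : \sum_x quad_char x = - \sum_x quad_char x.
  rewrite {1}(reindex_inj (mulfI g0)) -sumrN; apply: eq_bigr => x _.
  by rewrite quad_charM {1}/quad_char (negbTE g0) (negbTE g1) mulN1r.
lia.
Qed.

(** For a != 0 the substitution y = 1 + a / x turns the sum into that of the character
over all y other than 1. *)
Lemma quad_char_corr a : \sum_x quad_char x * quad_char (x + a) =
  if a == 0 then (2 * h)%N%:Z else -1.
Proof.
case: eqVneq => [->|a0].
  rewrite (bigD1 0) //= quad_char0 mul0r add0r.
  rewrite (eq_bigr (fun _ => 1)); last by move=> x x0; rewrite addr0 quad_char_sqr.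
  rewrite sumr_const natz; congr (_%:Z).
  have := cardC (pred1 (0 : F)); rewrite card1 cardF add1n => -[<-].
  by apply: eq_card => x; rewrite !inE.
rewrite (bigD1 0) //= quad_char0 mul0r add0r.
have E : \sum_(x | x != 0) quad_char x * quad_char (x + a) =
    \sum_(y | y != 1) quad_char y.
  rewrite [RHS](reindex_onto (fun x => 1 + a / x) (fun y => a / (y - 1))) /=; last first.
    by move=> y y1; rewrite invf_div mulrC divfK // addrC subrK.
  apply: eq_big => [x|x x0].
    have Ex : 1 + a / x - 1 = a / x by rewrite addrC addKr.
    rewrite -[1 + a / x == 1]subr_eq0 !Ex mulf_eq0 invr_eq0 (negbTE a0) /=.
    case: (eqVneq x 0) => [->|x0] //=.
    by rewrite invf_div mulrC divfK ?eqxx.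
  have -> : x + a = x * (1 + a / x) by rewrite mulrDr mulr1 mulrC divfK.
  by rewrite quad_charM mulrA quad_char_sqr // mul1r.
have := quad_char_sum; rewrite (bigD1 1) //= quad_char1 E => /eqP.
by rewrite addrC addr_eq0 => /eqP.
Qed.

Definition delta0 (x : F) : int := (x == 0)%:R.

(** The correlation of two combinations of the character, the indicator of 0 and 1; it
is applied to one coordinate of a point at a time. *)
Lemma corr_sum (A B C A' B' C' : int) b :
  \sum_x (A * quad_char x + B * delta0 x + C) *
         (A' * quad_char (x + b) + B' * delta0 (x + b) + C') =
  A * A' * (if b == 0 then (2 * h)%N%:Z else -1) + A * B' * quad_char (- b) + A' * B * quad_char b
  + B * B' * (b == 0)%:R + B * C' + B' * C + C * C' * (2 * h).+1%:Z.
Proof.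
rewrite -quad_char_corr.
have sd (G : F -> int) v : \sum_x delta0 (x + v) * G x = G (- v).
  rewrite (bigD1 (- v)) //= /delta0 addNr eqxx mul1r big1 ?addr0 // => x xv.
  by rewrite addr_eq0 (negbTE xv) mul0r.
have sd0 (G : F -> int) : \sum_x delta0 x * G x = G 0.
  by have := sd G 0; rewrite oppr0 => <-; apply: eq_bigr => x _; rewrite addr0.
have sq : \sum_x quad_char (x + b) = 0.
  rewrite -[RHS]quad_char_sum [RHS](reindex_inj (addIr b)) //.
have s1 : \sum_(x : F) (1 : int) = (2 * h).+1%:Z by rewrite sumr_const cardF natz.
have -> : (b == 0)%:R = delta0 b by [].
rewrite (eq_bigr (fun x => A * A' * (quad_char x * quad_char (x + b))
   + A * B' * (delta0 (x + b) * quad_char x) + A * C' * quad_char x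
   + A' * B * (delta0 x * quad_char (x + b)) + B * B' * (delta0 x * delta0 (x + b))
   + B * C' * (delta0 x * 1) + A' * C * quad_char (x + b) + B' * C * (delta0 (x + b) * 1)
   + C * C' * 1)); last by move=> x _; ring.
rewrite !big_split /= -!mulr_sumr quad_char_sum sq s1 (sd quad_char) (sd (fun=> 1)).
rewrite (sd0 (fun x => quad_char (x + b))) (sd0 (fun x => delta0 (x + b))) (sd0 (fun=> 1)).
rewrite !add0r. ring.
Qed.
End QuadraticCharacter.

Section TwinPrimePowers.
Variables (F1 F2 : finFieldType) (h : nat).
Hypotheses (card1 : #|F1| = (2 * h).+1) (card2 : #|F2| = (2 * h.+1).+1).
Let chi1 := @quad_char F1 h.
Let chi2 := @quad_char F2 h.+1.

(** The complement of the twin prime power difference set. *)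
Definition twin_set : {set F1 * F2} :=
  [set z | (z.2 != 0) && ((z.1 == 0) || (chi1 z.1 * chi2 z.2 == -1))].

(** The function with value -1 on [twin_set] and 1 elsewhere, as a combination of
products of functions of one coordinate, so that its correlations can be computed one
coordinate at a time. *)
Definition twin_sign (z : F1 * F2) : int :=
  chi1 z.1 * chi2 z.2 + (1 + delta0 z.1) * delta0 z.2 - delta0 z.1.

Lemma twin_signE z : twin_sign z = 1 - 2 * (z \in twin_set)%:R.
Proof.
rewrite /twin_sign inE /delta0; case: z => x y /=.
case: (eqVneq x 0) => [->|x0]; case: (eqVneq y 0) => [->|y0] /=;
  rewrite ?mulr0 ?mulr1 /chi1 /chi2 ?quad_char0 ?mul0r ?mulr0 ?add0r ?addr0 ?subr0 //.
by case: (quad_char_pm h x0) => ->; case: (quad_char_pm h.+1 y0) => ->.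
Qed.

Lemma twin_sign_sum : \sum_z twin_sign z = -1.
Proof.
rewrite -(pair_bigA _ (fun x y => twin_sign (x, y))) /=.
transitivity (\sum_(x : F1) ((1 + delta0 x) - delta0 x * (2 * h.+1).+1%:Z)).
  apply: eq_bigr => x _.
  have := corr_sum card2 (chi1 x) (1 + delta0 x) (- delta0 x) 0 0 1 0.
  rewrite eqxx oppr0 quad_char0 => E.
  rewrite (_ : \sum_y twin_sign (x, y) = \sum_y (chi1 x * chi2 y + (1 + delta0 x) * delta0 y - delta0 x)
    * (0 * chi2 (y + 0) + 0 * delta0 (y + 0) + 1)).
    by rewrite E; ring.
  by apply: eq_bigr => y _; rewrite /twin_sign /=; ring.
have := corr_sum card1 0 (1 - (2 * h.+1).+1%:Z) 1 0 0 1 0.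
rewrite eqxx oppr0 quad_char0 => E.
rewrite (_ : \sum_x _ = \sum_(x : F1) (0 * quad_char h x + (1 - (2 * h.+1).+1%:Z) * delta0 x + 1) *
       (0 * quad_char h (x + 0) + 0 * delta0 (x + 0) + 1)).
  rewrite E; lia.
by apply: eq_bigr => x _; ring.
Qed.

(** The cross term chi1(-a) chi2(-b) + chi1(a) chi2(b) vanishes because -1 is a square
in exactly one of the two fields, their orders being consecutive odd numbers. *)
Lemma twin_sign_corr (w : F1 * F2) : w != 0 -> \sum_z twin_sign z * twin_sign (z + w) = -1.
Proof.
case: w => a b ab0.
rewrite -(pair_bigA _ (fun x y => twin_sign (x, y) * twin_sign ((x, y) + (a, b)))) /=.
pose X2 := if b == 0 then (2 * h.+1)%N%:Z else -1.
pose q2 := (2 * h.+1).+1%:Z.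
transitivity (\sum_(x : F1)
  ( X2 * ((1 * chi1 x + 0 * delta0 x + 0) * (1 * chi1 (x + a) + 0 * delta0 (x + a) + 0))
  + chi2 (- b) * ((1 * chi1 x + 0 * delta0 x + 0) * (0 * chi1 (x + a) + 1 * delta0 (x + a) + 1))
  + chi2 b * ((0 * chi1 x + 1 * delta0 x + 1) * (1 * chi1 (x + a) + 0 * delta0 (x + a) + 0))
  + (b == 0)%:R * ((0 * chi1 x + 1 * delta0 x + 1) * (0 * chi1 (x + a) + 1 * delta0 (x + a) + 1))
  + 1 * ((0 * chi1 x + 1 * delta0 x + 1) * (0 * chi1 (x + a) + (-1) * delta0 (x + a) + 0))
  + 1 * ((0 * chi1 x + (-1) * delta0 x + 0) * (0 * chi1 (x + a) + 1 * delta0 (x + a) + 1))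
  + q2 * ((0 * chi1 x + (-1) * delta0 x + 0) * (0 * chi1 (x + a) + (-1) * delta0 (x + a) + 0)))).
  apply: eq_bigr => x _.
  have := corr_sum card2 (chi1 x) (1 + delta0 x) (- delta0 x)
    (chi1 (x + a)) (1 + delta0 (x + a)) (- delta0 (x + a)) b.
  rewrite -/X2 -/q2 -/chi2 => E.
  rewrite (_ : \sum_y _ = \sum_y (chi1 x * chi2 y + (1 + delta0 x) * delta0 y - delta0 x)
    * (chi1 (x + a) * chi2 (y + b) + (1 + delta0 (x + a)) * delta0 (y + b) - delta0 (x + a))) //.
  by rewrite E; ring.
rewrite !big_split /= -!mulr_sumr !(corr_sum card1) -/chi1.
have N1 : chi1 (- a) * chi2 (- b) + chi1 a * chi2 b = 0.
  rewrite -[- a]mulN1r -[- b]mulN1r /chi1 /chi2 !quad_charM // (quad_charN1 card1) (quad_charN1 card2).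
  by rewrite exprS mulN1r -(signr_odd _ h); case: (odd h); rewrite ?expr0 ?expr1; ring.
have a00 : chi1 0 = 0 by apply: quad_char0.
have b00 : chi2 0 = 0 by apply: quad_char0.
move: ab0 N1; rewrite /X2 /q2 -[(a, b) != 0]/(~~ ((a == 0) && (b == 0))).
case: (eqVneq a 0) => [->|a0]; case: (eqVneq b 0) => [->|b0] //= _;
  rewrite ?oppr0 ?a00 ?b00 => N1; lia.
Qed.

Lemma card_twin_set : #|twin_set| = (2 * h.+1 ^ 2)%N.
Proof.
have := twin_sign_sum; under eq_bigr => z _ do rewrite twin_signE.
rewrite sumrB sumr_const -mulr_sumr -natr_sum card_prod card1 card2.
rewrite -big_mkcond /= sum1_card !natz -mulnn; move: #|_| => k; clear; nia.
Qed.

(** Twice the indicator of [twin_set] is 1 minus [twin_sign], so the count follows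
from the correlation and the sum of [twin_sign]. *)
Lemma twin_set_diff (w : F1 * F2) : w != 0 ->
  #|[set z : F1 * F2 | (z \in twin_set) && (z + w \in twin_set)]| = (h.+1 ^ 2)%N.
Proof.
move=> w0; have sumw : \sum_(z : F1 * F2) twin_sign (z + w) = -1.
  by rewrite -twin_sign_sum [RHS](reindex_inj (addIr w)).
have E : \sum_(z : F1 * F2) (1 - twin_sign z) * (1 - twin_sign (z + w)) =
    4 * #|[set z : F1 * F2 | (z \in twin_set) && (z + w \in twin_set)]|%:R.
  rewrite -sum1_card natr_sum mulr_sumr [RHS]big_mkcond; apply: eq_bigr => z _.
  rewrite !twin_signE inE; by case: (z \in _); case: (z + w \in _).
have : \sum_(z : F1 * F2) (1 - twin_sign z) * (1 - twin_sign (z + w)) =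
   \sum_(z : F1 * F2) (1 - twin_sign z - twin_sign (z + w) + twin_sign z * twin_sign (z + w)).
  by apply: eq_bigr => z _; ring.
rewrite E !big_split /= !sumrN sumr_const twin_sign_sum sumw twin_sign_corr //.
rewrite card_prod card1 card2 !natz -mulnn; move: #|_| => k; clear; nia.
Qed.

End TwinPrimePowers.

(** * Designs developed from a starter block *)

(** The hypotheses [diffE], [diffU], [diff0] say that the multiples of [B] by [S] have
every difference with nonzero second coordinate exactly once, and no other difference;
[transE], [transU], [B0] say that the second coordinates of these multiples run
exactly once through the nonzero elements of [K]. *)
Section OneRotational.
Variables (H : finZmodType) (K : finFieldType) (B : {set H * K}) (S : {set K}).
Hypotheses
  (cardB : #|B| = #|H|.+1)
  (diffE : forall (x : H) (u : K), u != 0 -> exists P Q s,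
     [/\ P \in B, Q \in B, s \in S, P.1 - Q.1 = x & s * (P.2 - Q.2) = u])
  (diffU : forall P Q s P' Q' s', P \in B -> Q \in B -> s \in S ->
     P' \in B -> Q' \in B -> s' \in S -> P != Q -> P.1 - Q.1 = P'.1 - Q'.1 ->
     s * (P.2 - Q.2) = s' * (P'.2 - Q'.2) -> [/\ P = P', Q = Q' & s = s'])
  (diff0 : forall P Q, P \in B -> Q \in B -> P != Q -> P.2 != Q.2)
  (transE : forall u : K, u != 0 -> exists P s, [/\ P \in B, s \in S & s * P.2 = u])
  (transU : forall P s P' s', P \in B -> s \in S -> P' \in B -> s' \in S ->
     s * P.2 = s' * P'.2 -> P = P' /\ s = s')
  (B0 : forall P, P \in B -> P.2 != 0) (S0 : 0 \notin S).

Let V := option (H * K).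

Definition shifted_block (s : K) (g : H * K) : {set V} :=
  [set Some (P.1 + g.1, s * P.2 + g.2) | P in B].
Definition fibre_block (c : K) : {set V} := None |: [set Some (x, c) | x : H].
Definition rot_blocks : {set {set V}} :=
  [set fibre_block c | c : K] :|: [set shifted_block s g | s in S, g in [set: H * K]].
(** The blocks developed along H only, completed by the block through the fixed point.
*)
Definition rot_class (c : K) : {set {set V}} :=
  fibre_block c |: [set shifted_block s (x, c) | s in S, x in [set: H]].
Definition rot_classes : {set {set {set V}}} := [set rot_class c | c : K].

Lemma scale_neq0 s : s \in S -> s != 0.
Proof. by move=> sS; apply: contraNneq S0 => <-. Qed.

Lemma shifted_blockP s g y : reflect
  (exists2 P, P \in B & y = Some (P.1 + g.1, s * P.2 + g.2)) (y \in shifted_block s g).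
Proof. exact: imsetP. Qed.

Lemma fibre_blockP c (y : V) :
  reflect (y = None \/ exists x, y = Some (x, c)) (y \in fibre_block c).
Proof.
rewrite !inE; apply: (iffP orP) => -[]; rewrite ?eqxx.
- by move/eqP; left.
- by move/imsetP => [x _ ->]; right; exists x.
- by move/eqP; left.
- by move=> [x ->]; right; apply: imset_f.
Qed.

Lemma fibre_block_snd c x u : Some (x, u) \in fibre_block c -> u = c.
Proof. by move=> /fibre_blockP[//|[? [_ ->]]]. Qed.

Lemma rot_blocksP b : reflect
  ((exists c, b = fibre_block c) \/ exists s g, s \in S /\ b = shifted_block s g)
  (b \in rot_blocks).
Proof.
rewrite inE; apply: (iffP orP) => -[].
- by move/imsetP => [c _ ->]; left; exists c.
- by move/imset2P => [s g sS _ ->]; right; exists s, g.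
- by move=> [c ->]; left; apply: imset_f.
- by move=> [s [g [sS ->]]]; right; apply: imset2_f.
Qed.

Lemma rot_classP c b : reflect
  (b = fibre_block c \/ exists s x, s \in S /\ b = shifted_block s (x, c))
  (b \in rot_class c).
Proof.
rewrite !inE; apply: (iffP orP) => -[].
- by move/eqP; left.
- by move/imset2P => [s g sS _ ->]; right; exists s, g.
- by move=> ->; left.
- by move=> [s [g [sS ->]]]; right; apply: imset2_f.
Qed.

Lemma card_shifted_block s g : s \in S -> #|shifted_block s g| = #|H|.+1.
Proof.
move=> sS; rewrite card_imset ?cardB // => P Q [/addIr E1 /addIr].
by move/(mulfI (scale_neq0 sS)) => E2; case: P Q E1 E2 => [? ?] [? ?] /= -> ->.
Qed.

Lemma card_fibre_block c : #|fibre_block c| = #|H|.+1.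
Proof.
rewrite cardsU1 card_imset; last by move=> x x' [].
by case: imsetP => [[]|].
Qed.

(** Two common points have a difference, which determines their positions in [B] and
the scalar; the translation is then determined by one of the points. *)
Lemma shifted_block_inj2 s g s' g' y y' : s \in S -> s' \in S -> y != y' ->
  y \in shifted_block s g -> y' \in shifted_block s g ->
  y \in shifted_block s' g' -> y' \in shifted_block s' g' -> s = s' /\ g = g'.
Proof.
move=> sS sS' yy /shifted_blockP[P PB EP] /shifted_blockP[Q QB EQ].
move=> /shifted_blockP[P' PB' EP'] /shifted_blockP[Q' QB' EQ'].
move: EP' EQ'; rewrite EP EQ => -[E1 E2] [E3 E4].
have PQ : P != Q by apply: contraNneq yy => PQ; rewrite EP EQ PQ.
have [||E5 E6 E7] := diffU PB QB sS PB' QB' sS' PQ.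
- have := congr2 (fun u v : H => u - v) E1 E3.
  by rewrite !opprD ![_ + _ + (- _ - _)]addrACA !subrr !addr0.
- have := congr2 (fun u v : K => u - v) E2 E4.
  by rewrite !opprD ![_ + _ + (- _ - _)]addrACA !subrr !addr0 -!mulrBr.
subst P' Q' s'; split => //.
by move: E1 E2 => /addrI E1 /addrI E2; case: g g' E1 E2 {EP EQ E3 E4} => [? ?] [? ?] /= -> ->.
Qed.

Lemma shifted_block_two s g y y' : s \in S -> y \in shifted_block s g -> y' \in shifted_block s g ->
  y != y' -> exists x c x' c', [/\ y = Some (x, c), y' = Some (x', c') & c != c'].
Proof.
move=> sS /shifted_blockP[P PB EP] /shifted_blockP[Q QB EQ] yy.
have PQ : P != Q by apply: contraNneq yy => PQ; rewrite EP EQ PQ.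
do 4 eexists; split; [exact: EP | exact: EQ |].
by rewrite (inj_eq (addIr _)) (inj_eq (mulfI (scale_neq0 sS))) diff0.
Qed.

Lemma rot_block_unique b b' y y' : b \in rot_blocks -> b' \in rot_blocks -> y != y' ->
  y \in b -> y' \in b -> y \in b' -> y' \in b' -> b = b'.
Proof.
have mixed c s g : s \in S -> y != y' -> y \in fibre_block c -> y' \in fibre_block c ->
    y \in shifted_block s g -> y' \in shifted_block s g -> False.
  move=> sS yy f1 f2 h1 h2; have [x [k [x' [k' [E1 E2 kk]]]]] := shifted_block_two sS h1 h2 yy.
  move: f1 f2 kk => /fibre_blockP; rewrite E1 => -[//|[? [_ ->]]].
  by move=> /fibre_blockP; rewrite E2 => -[//|[? [_ ->]]]; rewrite eqxx.
move=> /rot_blocksP[[c ->]|[s [g [sS ->]]]] /rot_blocksP[[c' ->]|[s' [g' [sS' ->]]]] yy h1 h2 h3 h4.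
- clear mixed; case: y y' yy h1 h2 h3 h4 => [[x u]|] [[x' u']|] // _ h1 h2 h3 h4.
  + by rewrite -(fibre_block_snd h1) -(fibre_block_snd h3).
  + by rewrite -(fibre_block_snd h1) -(fibre_block_snd h3).
  + by rewrite -(fibre_block_snd h2) -(fibre_block_snd h4).
- by case: (mixed c s' g').
- by case: (mixed c' s g).
- by have [-> ->] := shifted_block_inj2 sS sS' yy h1 h2 h3 h4.
Qed.

Lemma rot_block_exists y y' : y != y' -> exists2 b, b \in rot_blocks & (y \in b) && (y' \in b).
Proof.
have fib c : fibre_block c \in rot_blocks by apply/rot_blocksP; left; exists c.
case: y => [[x c]|]; case: y' => [[x' c']|] // yy.
- have [->|cc] := eqVneq c c'.
    by exists (fibre_block c') => //; apply/andP; split; apply/fibre_blockP; right; eexists.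
  have [|P [Q [s [PB QB sS E1 E2]]]] := diffE (x - x') (_ : c - c' != 0); first by rewrite subr_eq0.
  exists (shifted_block s (x - P.1, c - s * P.2)).
    by apply/rot_blocksP; right; do 2 eexists; split; first exact: sS.
  apply/andP; split; apply/shifted_blockP.
    by exists P => //=; rewrite addrC subrK addrC subrK.
  exists Q => //=; congr (Some (_, _)).
    have -> : x = P.1 - Q.1 + x' by rewrite E1 subrK.
    by rewrite addrAC [P.1 - Q.1 - P.1]addrAC subrr add0r addrA subrr add0r.
  have -> : c = s * (P.2 - Q.2) + c' by rewrite E2 subrK.
  by ring.
- exists (fibre_block c) => //; apply/andP; split; apply/fibre_blockP; last by left.
  by right; eexists.
- exists (fibre_block c') => //; apply/andP; split; apply/fibre_blockP; first by left.
  by right; eexists.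
Qed.

Lemma card_H_gt0 : (0 < #|H|)%N.
Proof. by apply/card_gt0P; exists 0. Qed.

Lemma rot_block_card b : b \in rot_blocks -> #|b| = #|H|.+1.
Proof.
by move=> /rot_blocksP[[c ->]|[s [g [sS ->]]]]; rewrite ?card_fibre_block ?card_shifted_block.
Qed.

Lemma rot_class_sub c b : b \in rot_class c -> b \in rot_blocks.
Proof.
move=> /rot_classP[->|[s [x [sS ->]]]]; apply/rot_blocksP; first by left; exists c.
by right; exists s, (x, c).
Qed.

(** A block contains two points and so determines its scalar and translation, in
particular the second coordinate of the translation, which indexes the class. *)
Lemma rot_class_inj c c' b : b \in rot_class c -> b \in rot_class c' -> c = c'.
Proof.
have two : (1 < #|H|.+1)%N by rewrite ltnS card_H_gt0.
have mixed c1 s g : s \in S -> fibre_block c1 = shifted_block s g -> False.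
  move=> sS E; have : None \in fibre_block c1 by apply/fibre_blockP; left.
  by rewrite E => /shifted_blockP[].
move=> /rot_classP[->|[s [x [sS ->]]]] /rot_classP[|[s' [x' [sS' ]]]].
- move=> E; have : Some (0, c) \in fibre_block c by apply/fibre_blockP; right; exists 0.
  by rewrite E => /fibre_blockP[//|[? [_ ->]]].
- by move/mixed => /(_ sS').
- by move/esym/mixed => /(_ sS).
- move=> E; have := two; rewrite -(card_shifted_block (x, c) sS) => /card_gt1P[y [y' [h1 h2 yy]]].
  have h3 := h1; have h4 := h2; rewrite E in h3 h4.
  by have [_ [_ ->]] := shifted_block_inj2 sS sS' yy h1 h2 h3 h4.
Qed.

Lemma rot_class_cover c y : exists2 b, b \in rot_class c & y \in b.
Proof.
case: y => [[x u]|]; last first.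
  by exists (fibre_block c); [apply/rot_classP; left | apply/fibre_blockP; left].
have [->|uc] := eqVneq u c.
  by exists (fibre_block c); [apply/rot_classP; left | apply/fibre_blockP; right; exists x].
have [|P [s [PB sS E]]] := transE (_ : u - c != 0); first by rewrite subr_eq0.
exists (shifted_block s (x - P.1, c)); first by apply/rot_classP; right; exists s, (x - P.1).
by apply/shifted_blockP; exists P => //=; rewrite addrC subrK E subrK.
Qed.

Lemma rot_class_disjoint c b b' y : b \in rot_class c -> b' \in rot_class c ->
  y \in b -> y \in b' -> b = b'.
Proof.
have mixed s x : s \in S -> y \in fibre_block c -> y \in shifted_block s (x, c) -> False.
  move=> sS /fibre_blockP h /shifted_blockP[P PB E]; move: h; rewrite E => -[//|[x' [_ /eqP]]].
  by rewrite -subr_eq0 addrK mulf_eq0 (negbTE (scale_neq0 sS)) (negbTE (B0 PB)).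
move=> /rot_classP[->|[s [x [sS ->]]]] /rot_classP[->|[s' [x' [sS' ->]]]] h1 h2 //.
- by case: (mixed s' x').
- by case: (mixed s x).
move: h1 h2 => /shifted_blockP[P PB E1] /shifted_blockP[P' PB' ].
rewrite E1 => -[E2 /addIr E3].
have [EP Es] := transU PB sS PB' sS' E3.
by move: E2; rewrite EP Es => /addrI ->.
Qed.

Lemma rot_RBIBD : is_RBIBD (#|H| * #|K| + 1) #|H|.+1 1 rot_blocks rot_classes.
Proof.
split; split.
- by rewrite card_option card_prod addn1.
- exact: rot_block_card.
- move=> e /eqP/cards2P[y [y' [yy ->]]].
  have [b bA /andP[yb yb']] := rot_block_exists yy.
  apply/eqP/cards1P; exists b; apply/setP => b'; rewrite in_set in_set1.
  apply/andP/eqP => [[bA' /subsetP sub]|->]; last first.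
    by split => //; apply/subsetP => w; rewrite !inE => /orP[] /eqP->.
  by apply: (rot_block_unique bA' bA yy) => //; apply: sub; rewrite !inE eqxx ?orbT.
- apply/and3P; split.
  + apply/eqP/setP => b; apply/bigcupP/idP => [[P /imsetP[c _ ->]]|]; first exact: rot_class_sub.
    move=> /rot_blocksP[[c ->]|[s [g [sS ->]]]].
      by exists (rot_class c); [apply: imset_f | apply/rot_classP; left].
    exists (rot_class g.2); first exact: imset_f.
    by apply/rot_classP; right; exists s, g.1; split => //; case: g.
  + apply/trivIsetP => P P' /imsetP[c _ ->] /imsetP[c' _ ->] cc.
    rewrite -setI_eq0; apply/set0Pn => -[b]; rewrite inE => /andP[b1 b2].
    by rewrite (rot_class_inj b1 b2) eqxx in cc.
  + apply/imsetP => -[c _ E]; have : fibre_block c \in rot_class c by apply/rot_classP; left.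
    by rewrite -E inE.
- move=> P /imsetP[c _ ->]; apply/and3P; split.
  + apply/eqP/setP => y; rewrite [RHS]inE; apply/bigcupP.
    by have [b bc yb] := rot_class_cover c y; exists b.
  + apply/trivIsetP => b b' bc bc' bb; rewrite -setI_eq0; apply/set0Pn => -[y].
    by rewrite inE => /andP[y1 y2]; rewrite (rot_class_disjoint bc bc' y1 y2) eqxx in bb.
  + apply/negP => /rot_class_sub/rot_block_card; by rewrite cards0.
Qed.

Definition translation_fun (g : H * K) (y : V) : V :=
  if y is Some x then Some (x.1 + g.1, x.2 + g.2) else None.

Lemma translation_inj g : injective (translation_fun g).
Proof.
case=> [[x c]|] [[x' c']|] //= [/addIr -> /addIr ->] //.
Qed.

Definition translation g : {perm V} := perm (@translation_inj g).

Lemma translationE g y : translation g y = translation_fun g y.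
Proof. exact: permE. Qed.

Lemma translationM (g g' : H * K) :
  translation (g.1 + g'.1, g.2 + g'.2) = (translation g * translation g')%g.
Proof.
by apply/permP => -[x|]; rewrite permM !translationE //= !addrA.
Qed.

Lemma translation_eq g g' : translation g = translation g' -> g = g'.
Proof.
move/permP/(_ (Some (0, 0))); rewrite !translationE /= !add0r.
by case: g g' => [? ?] [? ?] [-> ->].
Qed.

Lemma translation_fibre g c : [set translation g y | y in fibre_block c] = fibre_block (c + g.2).
Proof.
apply/eqP; rewrite eqEcard card_imset; last exact: perm_inj.
rewrite !card_fibre_block leqnn andbT; apply/subsetP => z /imsetP[y /fibre_blockP h ->].
rewrite translationE; apply/fibre_blockP; case: h => [->|[x ->]]; [by left | right].
by exists (x + g.1).
Qed.

Lemma translation_shifted g s g' : s \in S ->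
  [set translation g y | y in shifted_block s g'] = shifted_block s (g'.1 + g.1, g'.2 + g.2).
Proof.
move=> sS; apply/eqP; rewrite eqEcard (card_imset _ (@perm_inj _ (translation g))).
rewrite !card_shifted_block // leqnn andbT; apply/subsetP => z /imsetP[y /shifted_blockP[P PB ->] ->].
by rewrite translationE; apply/shifted_blockP; exists P => //=; rewrite !addrA.
Qed.

Lemma translation_block g b : b \in rot_blocks -> [set translation g y | y in b] \in rot_blocks.
Proof.
move=> /rot_blocksP[[c ->]|[s [g' [sS ->]]]]; apply/rot_blocksP.
  by rewrite translation_fibre; left; eexists.
by rewrite translation_shifted //; right; do 2 eexists; split; first exact: sS.
Qed.

Lemma translation_class g c :
  [set [set translation g y | y in (b : {set V})] | b in rot_class c] = rot_class (c + g.2).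
Proof.
have sub g1 c1 : [set [set translation g1 y | y in (b : {set V})] | b in rot_class c1]
    \subset rot_class (c1 + g1.2).
  apply/subsetP => z /imsetP[b /rot_classP h ->]; apply/rot_classP.
  case: h => [->|[s [x [sS ->]]]]; first by rewrite translation_fibre; left.
  by rewrite translation_shifted //; right; do 2 eexists; split; first exact: sS.
apply/eqP; rewrite eqEsubset sub /=; apply/subsetP => b bc.
have := subsetP (sub (- g.1, - g.2) (c + g.2)); rewrite /= addrK => sub'.
have E : b = [set translation g y | y in [set translation (- g.1, - g.2) y | y in b]].
  rewrite -imset_comp -[LHS]imset_id; apply: eq_imset => y /=.
  by rewrite -permM -translationM /= !addNr translationE; case: y => [[x u]|] //=; rewrite !addr0.
by rewrite E; apply: imset_f; apply: sub'; apply: imset_f.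
Qed.

Let GT : finGroupType := (H * K)%type.

(** The translations again, with domain seen as a finite group whose product is the
addition of pairs. *)
Definition translation_grp (g : GT) : {perm V} := translation g.

Lemma translation_grpM : {in [set: GT] &, {morph translation_grp : g g' / (g * g')%g}}.
Proof. by move=> g g' _ _; apply: translationM. Qed.

Canonical translation_morphism := Morphism translation_grpM.

Lemma rot_one_rotational : one_rotational rot_blocks rot_classes [set: GT].
Proof.
split; first by rewrite cardsT card_option.
exists (translation_morphism @* [set: GT])%G; split.
- rewrite isog_sym; apply: sub_isog => //.
  by apply/injmP => g g' _ _; apply: translation_eq.
- split; apply/subsetP => a /morphimP[g _ _ ->]; rewrite !inE /=; apply/subsetP => b bA.
    rewrite inE /= /setact /=.
    rewrite -[imset _ _]/([set translation g y | y in b]); exact: translation_block.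
  rewrite inE; move: bA => /imsetP[c _ ->].
  rewrite /= /setact /= -[imset _ _]/([set [set translation g y | y in (b : {set V})] | b in rot_class c]).
  by rewrite translation_class; apply: imset_f.
exists None; split.
  by move=> a /morphimP[g _ _ ->]; rewrite /= /translation_grp translationE.
move=> [[x c]|] // [[x' c']|] // _ _.
exists (translation_grp (x' - x, c' - c)); split.
  split; first by apply: mem_morphim; rewrite inE.
  by rewrite /translation_grp translationE /= addrC subrK addrC subrK.
move=> a [/morphimP[[g1 g2] _ _ ->]] /=; rewrite /translation_grp translationE /= => -[<- <-].
by rewrite ![_ + g1]addrC ![_ + g2]addrC !addrK.
Qed.

End OneRotational.

(** * Symmetric starter blocks *)

(** The labels are the c-th powers, and [sg] gives the two signs. The hypotheses on
labels say that the [a t], and for each nonzero w the differences and sums of the [a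
t], [a t'] with t - t' = w, represent every label exactly once. *)
Section Starter.
Variables (H : finZmodType) (K : finFieldType) (D : {set H}) (a : H -> K) (c : nat).
Let sg (e : bool) : K := (-1) ^+ e.
Hypotheses (codd : ~~ odd c) (c_gt0 : (0 < c)%N) (two0 : 2%:R != 0 :> K)
  (cardD : (2 * #|D|)%N = #|H|.+1)
  (labE : forall u : K, u != 0 -> exists2 t, t \in D & a t ^+ c = u ^+ c)
  (labU : forall t t', t \in D -> t' \in D -> a t ^+ c = a t' ^+ c -> t = t')
  (labdE : forall (w : H) (u : K), w != 0 -> u != 0 ->
     exists t t' e, [/\ t \in D, t' \in D, t - t' = w & (a t - sg e * a t') ^+ c = u ^+ c])
  (labdU : forall t t' e t1 t1' e1, t \in D -> t' \in D -> t1 \in D -> t1' \in D -> t != t' ->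
     t - t' = t1 - t1' -> (a t - sg e * a t') ^+ c = (a t1 - sg e1 * a t1') ^+ c ->
     [/\ t = t1, t' = t1' & e = e1])
  (a0 : forall t, t \in D -> a t != 0)
  (apm : forall t t', t \in D -> t' \in D -> t != t' -> a t != a t' /\ a t != - a t').

Definition starter_block : {set H * K} :=
  [set (t, sg e * a t) | t in D, e in [set: bool]].
(** One element of each pair w, - w of elements of label 1; comparing ranks in the
enumeration of K is an arbitrary way to choose. *)
Definition half_scalars : {set K} :=
  [set w : K | (w ^+ c == 1) && (enum_rank w < enum_rank (- w))%N].

Lemma starter_blockP P : reflect (exists t e, t \in D /\ P = (t, sg e * a t)) (P \in starter_block).
Proof.
apply: (iffP imset2P) => [[t e tD _ ->]|[t [e [tD ->]]]]; first by exists t, e.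
by exists t e.
Qed.

Lemma sg_sqr e : sg e * sg e = 1.
Proof. by rewrite /sg -expr2 sqrr_sign. Qed.

Lemma sg_neq0 e : sg e != 0.
Proof. by rewrite signr_eq0. Qed.

Lemma sg_label e : sg e ^+ c = 1.
Proof. by rewrite /sg -exprM mulnC exprM -signr_odd (negbTE codd) expr1n. Qed.

Lemma sgM e f : sg e * sg f = sg (e (+) f).
Proof. by rewrite /sg -signr_addb. Qed.

Lemma neq_opp (w : K) : w != 0 -> w != - w.
Proof. by move=> w0; rewrite -subr_eq0 opprK -mulr2n -mulr_natr mulf_neq0. Qed.

Lemma half_scalars_neq0 s : s \in half_scalars -> s != 0.
Proof.
rewrite inE => /andP[/eqP E _]; apply: contraTneq (oner_neq0 K) => s0.
by rewrite -E s0 expr0n gtn_eqF // negbK.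
Qed.

Lemma half_scalarsE w : w ^+ c = 1 -> exists e, sg e * w \in half_scalars.
Proof.
move=> wc; have w0 : w != 0.
  by apply: contraTneq (oner_neq0 K) => w0; rewrite -wc w0 expr0n gtn_eqF // negbK.
have Nc : (- w) ^+ c = 1 by rewrite -mulN1r exprMn wc mulr1 (sg_label true).
have : (enum_rank w != enum_rank (- w) :> nat).
  by rewrite (inj_eq val_inj) (inj_eq enum_rank_inj) neq_opp.
rewrite neq_ltn => /orP[h|h].
  by exists false; rewrite /sg expr0 mul1r inE wc eqxx.
by exists true; rewrite /sg expr1 mulN1r inE Nc eqxx opprK.
Qed.

Lemma half_scalarsU s s' e e' : s \in half_scalars -> s' \in half_scalars ->
  s * sg e = s' * sg e' -> s = s' /\ e = e'.
Proof.
move=> sS sS' E.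
have : s = s' * sg (e (+) e') by rewrite addbC -sgM mulrA -E -mulrA sg_sqr mulr1.
case: (boolP (e (+) e')) => ee Es.
  move: sS sS'; rewrite !inE Es /sg expr1 mulrN1 opprK => /andP[_ h] /andP[_ h'].
  by have := ltn_trans h h'; rewrite ltnn.
split; first by rewrite Es /sg expr0 mulr1.
by move: ee; case: e {E Es}; case: e'.
Qed.

Lemma half_scalars_label s : s \in half_scalars -> s ^+ c = 1.
Proof. by rewrite inE => /andP[/eqP]. Qed.

Lemma sg_inj e e' : sg e = sg e' -> e = e'.
Proof.
have := neq_opp (oner_neq0 K); rewrite /sg.
by case: e; case: e'; rewrite ?expr0 ?expr1 // => /eqP h /esym // /h.
Qed.

Lemma card_starter_block : #|starter_block| = #|H|.+1.
Proof.
rewrite -cardD mulnC -card_bool -cardsT -cardsX /starter_block curry_imset2X card_in_imset //.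
move=> [t e] [t' e'] /setXP[tD _] _ /= [<-] /(mulIf (a0 tD))/sg_inj -> //.
Qed.

Lemma starter_diff0 P Q : P \in starter_block -> Q \in starter_block -> P != Q -> P.2 != Q.2.
Proof.
move=> /starter_blockP[t [e [tD ->]]] /starter_blockP[t' [e' [tD' ->]]] PQ /=.
have [tt|tt] := eqVneq t t'.
  subst t'; have ee : e != e' by apply: contraNneq PQ => ->.
  rewrite (inj_eq (mulIf (a0 tD))) /sg.
  have := neq_opp (oner_neq0 K).
  by move: ee; case: e {PQ}; case: e' => // _; rewrite ?expr0 ?expr1 // eq_sym.
have [h1 h2] := apm tD tD' tt.
rewrite /sg; case: e {PQ}; case: e'; rewrite ?expr0 ?expr1 ?mul1r ?mulN1r ?eqr_opp //.
by rewrite eqr_oppLR.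
Qed.

Lemma sub_signs t t' e e' : sg e * a t - sg e' * a t' = sg e * (a t - sg (e (+) e') * a t').
Proof. by rewrite mulrBr mulrA sgM addbA addbb addFb. Qed.

Lemma sub_neg (y : K) : y - sg true * y = y * 2%:R.
Proof. by rewrite /sg expr1; ring. Qed.

(** The label of u determines t, t' and the relative sign; the remaining factor has
label 1, so it is, up to a common sign of the two points, an element of
[half_scalars]. *)
Lemma starter_diffE (x : H) (u : K) : u != 0 -> exists P Q s,
  [/\ P \in starter_block, Q \in starter_block, s \in half_scalars, P.1 - Q.1 = x
    & s * (P.2 - Q.2) = u].
Proof.
move=> u0.
have [t [t' [e [tD tD' tx lab]]]] : exists t t' e,
    [/\ t \in D, t' \in D, t - t' = x & (a t - sg e * a t') ^+ c = u ^+ c].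
  have [->|x0] := eqVneq x 0; last exact: labdE.
  have [|t tD lab] := labE (_ : u / 2%:R != 0); first by rewrite mulf_neq0 ?invr_eq0.
  exists t, t, true; split => //; first by rewrite subrr.
  by rewrite sub_neg exprMn lab -exprMn divfK.
set v := a t - _ in lab.
have v0 : v != 0.
  have : v ^+ c != 0 by rewrite lab expf_neq0.
  by rewrite expf_eq0 c_gt0.
have wc : (u / v) ^+ c = 1 by rewrite expr_div_n lab divff // expf_neq0.
have [f fS] := half_scalarsE wc.
exists (t, sg f * a t), (t', sg (f (+) e) * a t'), (sg f * (u / v)); split => //=.
- by apply/starter_blockP; exists t, f.
- by apply/starter_blockP; exists t', (f (+) e).
rewrite sub_signs addbA addbb addFb -/v.
by rewrite mulrACA sg_sqr mul1r divfK.
Qed.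

Lemma starter_diffU P Q s P' Q' s' : P \in starter_block -> Q \in starter_block ->
  s \in half_scalars -> P' \in starter_block -> Q' \in starter_block -> s' \in half_scalars ->
  P != Q -> P.1 - Q.1 = P'.1 - Q'.1 -> s * (P.2 - Q.2) = s' * (P'.2 - Q'.2) ->
  [/\ P = P', Q = Q' & s = s'].
Proof.
move=> PB QB sS PB' QB' sS' PQ E1 E2.
have nz : s * (P.2 - Q.2) != 0.
  by apply: mulf_neq0; [exact: half_scalars_neq0 | rewrite subr_eq0; exact: starter_diff0].
move: PB QB PB' QB' => /starter_blockP[t [e [tD EP]]] /starter_blockP[t' [e' [tD' EQ]]].
move=> /starter_blockP[t1 [e1 [tD1 EP']]] /starter_blockP[t1' [e1' [tD1' EQ']]].
move: PQ E1 E2 nz; rewrite EP EQ EP' EQ' /= !sub_signs => PQ E1 E2 nz.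
have lab : (a t - sg (e (+) e') * a t') ^+ c = (a t1 - sg (e1 (+) e1') * a t1') ^+ c.
  have := congr1 (fun y => y ^+ c) E2.
  by rewrite !exprMn (half_scalars_label sS) (half_scalars_label sS') !sg_label !mul1r.
have v0 : a t - sg (e (+) e') * a t' != 0.
  by apply: contraNneq nz => ->; rewrite !mulr0.
have [Et Et' Ee] : [/\ t = t1, t' = t1' & e (+) e' = e1 (+) e1'].
  have [tt|tt] := eqVneq t t'; last exact: labdU.
  subst t'; move: E1; rewrite subrr => /esym/eqP; rewrite subr_eq0 => /eqP E1; subst t1'.
  have ee : e (+) e'.
    by case: (e (+) e') v0 => //; rewrite /sg expr0 mul1r subrr eqxx.
  have v1 : a t1 - sg (e1 (+) e1') * a t1 != 0.
    have : (a t - sg (e (+) e') * a t) ^+ c != 0 by rewrite expf_neq0.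
    by rewrite lab expf_eq0 c_gt0.
  have ee1 : e1 (+) e1'.
    by case: (e1 (+) e1') v1 => //; rewrite /sg expr0 mul1r subrr eqxx.
  move: lab; rewrite ee ee1 !sub_neg !exprMn.
  by move/(mulIf (expf_neq0 c two0))/(labU tD tD1) => ->.
subst t1 t1'; move: E2; rewrite -Ee !mulrA => /(mulIf v0)/(half_scalarsU sS sS')[-> Ee1].
by subst e1; move: Ee => /addbI ->.
Qed.

Lemma starter_transE (u : K) : u != 0 -> exists P s,
  [/\ P \in starter_block, s \in half_scalars & s * P.2 = u].
Proof.
move=> u0; have [t tD lab] := labE u0.
have wc : (u / a t) ^+ c = 1 by rewrite expr_div_n lab divff // expf_neq0.
have [f fS] := half_scalarsE wc.
exists (t, sg f * a t), (sg f * (u / a t)); split => //=.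
  by apply/starter_blockP; exists t, f.
by rewrite mulrACA sg_sqr mul1r divfK // a0.
Qed.

Lemma starter_transU P s P' s' : P \in starter_block -> s \in half_scalars ->
  P' \in starter_block -> s' \in half_scalars -> s * P.2 = s' * P'.2 -> P = P' /\ s = s'.
Proof.
move=> /starter_blockP[t [e [tD ->]]] sS /starter_blockP[t' [e' [tD' ->]]] sS' /= E.
have lab : a t ^+ c = a t' ^+ c.
  have := congr1 (fun y => y ^+ c) E.
  by rewrite !exprMn (half_scalars_label sS) (half_scalars_label sS') !sg_label !mul1r.
have tt := labU tD tD' lab; subst t'.
move: E; rewrite !mulrA => /(mulIf (a0 tD))/(half_scalarsU sS sS')[-> ->] //.
Qed.

Lemma starter_neq0 P : P \in starter_block -> P.2 != 0.
Proof. by move=> /starter_blockP[t [e [tD ->]]]; rewrite /= mulf_neq0 ?sg_neq0 ?a0. Qed.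

Lemma half_scalars0 : 0 \notin half_scalars.
Proof. by apply/negP => /half_scalars_neq0; rewrite eqxx. Qed.

Lemma starter_one_rotational :
  exists_one_rotational_RBIBD (#|H| * #|K| + 1) #|H|.+1 1 [set: (H * K)%type].
Proof.
pose V : finType := option (H * K).
exists V, (rot_blocks starter_block half_scalars), (rot_classes starter_block half_scalars); split.
  apply: rot_RBIBD; [exact: card_starter_block | exact: starter_diffE | exact: starter_diffU
   | exact: starter_diff0 | exact: starter_transE | exact: starter_transU | exact: starter_neq0
   | exact: half_scalars0].
apply: rot_one_rotational; [exact: card_starter_block | exact: half_scalars0].
Qed.

End Starter.

(** * The bound Q *)

(** The sums of C(m, h) x^h and h C(m, h) x^h are (1 + x)^m and m x (1 + x)^(m - 1),
with x = d - 1. *)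
Lemma U_boundE (R : rcfType) d m : U_bound R d m.+1 =
  m.+1%:R * (d%:R - 1) * d%:R ^+ m - d%:R ^+ m.+1 + 1.
Proof.
rewrite /U_bound; set x : R := d%:R - 1; have dx : d%:R = 1 + x by rewrite /x; ring.
have binom k : \sum_(i < k.+1) 'C(k, i)%:R * x ^+ i = d%:R ^+ k.
  rewrite dx exprDn; apply: eq_bigr => i _.
  by rewrite expr1n mul1r mulr_natl.
rewrite big_add1 /= big_mkord.
have -> : \sum_(i < m.+1) 'C(m.+1, i.+1)%:R * x ^+ i.+1 * (i.+1%:R - 1) =
  \sum_(i < m.+1) m.+1%:R * x * ('C(m, i)%:R * x ^+ i) - \sum_(i < m.+1) 'C(m.+1, i.+1)%:R * x ^+ i.+1.
  rewrite -sumrB; apply: eq_bigr => i _; rewrite mulrBr mulr1; congr (_ - _).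
  have := mul_bin_diag m.+1 i; rewrite /= => /(congr1 (fun n => n%:R : R)); rewrite !natrM => E.
  by rewrite mulrAC [_%:R * _%:R]mulrC -E exprS; ring.
have := binom m.+1; rewrite big_ord_recl /= bin0 expr0 mulr1 => <-.
by rewrite -mulr_sumr binom; ring.
Qed.

(** The square root in Q is at least U, so Q is at least U^2; and U = d^(2 d - 2) (2
d^2 - 4 d + 1) + 1 is at least (3/2) d^(2 d) for d at least 8. *)
Lemma Q_bound_ge (R : rcfType) (d q : nat) : (8 <= d)%N ->
  Q_bound R d (2 * d).-1 < q%:R -> (9 * d ^ (4 * d) <= 4 * q)%N.
Proof.
move=> d8 Qq.
have Em : (2 * d).-1 = (2 * d).-2.+1 by lia.
pose y : R := d%:R; have y8 : 8 <= y by rewrite (ler_nat R 8 d).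
have UE : U_bound R d (2 * d).-1 = y ^+ (2 * d).-2 * (2 * y ^+ 2 - 4 * y + 1) + 1.
  rewrite {1}Em U_boundE -/y exprS.
  have -> : (2 * d).-2.+1%:R = 2 * y - 1 :> R.
    by rewrite -Em -subn1 natrB ?natrM //; lia.
  by ring.
have yp : 0 < y ^+ (2 * d).-2 by rewrite exprn_gt0 //; lra.
have U1 : 3 / 2 * y ^+ (2 * d) <= U_bound R d (2 * d).-1.
  have -> : y ^+ (2 * d) = y ^+ (2 * d).-2 * y ^+ 2 by rewrite -exprD; congr (_ ^+ _); lia.
  rewrite UE; move: yp; set Y := y ^+ _ => yp.
  have : 3 / 2 * y ^+ 2 <= 2 * y ^+ 2 - 4 * y + 1 by rewrite expr2; nra.
  rewrite -(ler_pM2l yp); lra.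
have U0 : 0 <= 3 / 2 * y ^+ (2 * d) by rewrite mulr_ge0 ?exprn_ge0 //; lra.
set U := U_bound R d _ in U1.
have QU : U ^+ 2 <= Q_bound R d (2 * d).-1.
  rewrite /Q_bound -/U; set r := Num.sqrt _.
  have rU : U <= r.
    have Un : 0 <= U by apply: le_trans U1.
    rewrite -[X in X <= _](ger0_norm Un) -sqrtr_sqr; apply: ler_wsqrtr.
    rewrite lerDl; apply: mulr_ge0; last exact: ler0n.
    by apply: mulr_ge0; rewrite ?exprn_ge0 ?ler0n.
  have : 0 <= U by apply: le_trans U1.
  nra.
have : (3 / 2 * y ^+ (2 * d)) ^+ 2 < q%:R.
  apply: le_lt_trans Qq; apply: le_trans QU; rewrite lerXn2r ?nnegrE //.
  exact: le_trans U1.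
rewrite exprMn -exprM => h.
rewrite -(ler_nat R) !natrM natrX -/y (_ : (4 * d = 2 * d * 2)%N); last lia.
rewrite expr_div_n in h; move: h; set Z := y ^+ _; lra.
Qed.

(** * Distributing the labels over the differences *)

Section Slots.
Variables (H : finZmodType) (D : {set H}) (half : nat).
Hypotheses (half0 : (0 < half)%N) (no2 : forall w : H, w != 0 -> w != - w)
  (diffD : forall w : H, w != 0 -> #|[set t in D | t - w \in D]| = half).

Definition diff_starts (w : H) : {set H} := [set t in D | t - w \in D].

(** Pairs with difference w are numbered by their first members. Since t, t' and t', t
must receive the same number, the numbering is taken from one of w, - w, chosen by the
ranks in the enumeration of H; the residue only bounds the number when t, t' are not
both in [D]. *)
Definition slot (t t' : H) : nat :=
  ((if enum_rank (t - t')%R < enum_rank (t' - t)%R then index t (enum (diff_starts (t - t')%R))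
    else index t' (enum (diff_starts (t' - t)%R))) %% half)%N.

Lemma slot_lt t t' : (slot t t' < half)%N.
Proof. exact: ltn_pmod. Qed.

Lemma slot_sym t t' : slot t t' = slot t' t.
Proof.
rewrite /slot; have [->//|tt] := eqVneq t t'.
have : (enum_rank (t - t') != enum_rank (t' - t) :> nat).
  by rewrite (inj_eq val_inj) (inj_eq enum_rank_inj) -(opprB t t') no2 ?subr_eq0.
by case: ltngtP.
Qed.

Lemma diff_starts_mem t t' : t \in D -> t' \in D -> t \in diff_starts (t - t').
Proof. by move=> tD tD'; rewrite inE tD opprB addrCA subrr addr0. Qed.

Lemma index_diff_starts w t : w != 0 -> t \in diff_starts w ->
  (index t (enum (diff_starts w)) %% half)%N = index t (enum (diff_starts w)).
Proof.
by move=> w0 tw; rewrite modn_small // -(diffD w0) cardE index_mem mem_enum.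
Qed.

Lemma slot_inj t t' u u' : t \in D -> t' \in D -> u \in D -> u' \in D -> t != t' ->
  t - t' = u - u' -> slot t t' = slot u u' -> t = u /\ t' = u'.
Proof.
move=> tD tD' uD uD' tt E; have E' : t' - t = u' - u by rewrite -opprB E opprB.
have w0 : t - t' != 0 by rewrite subr_eq0.
have w0' : t' - t != 0 by rewrite subr_eq0 eq_sym.
have m1 := diff_starts_mem tD tD'; have m2 := diff_starts_mem uD uD'.
have m3 := diff_starts_mem tD' tD; have m4 := diff_starts_mem uD' uD.
rewrite -E in m2; rewrite -E' in m4.
rewrite /slot -E -E'; case: ifP => _; rewrite !index_diff_starts // => Ei.
  have tu : t = u.
    by rewrite -(nth_index 0 (_ : t \in enum (diff_starts (t - t')))) ?mem_enum // Ei nth_index ?mem_enum.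
  by split => //; move: E; rewrite tu => /addrI/oppr_inj.
have tu : t' = u'.
  by rewrite -(nth_index 0 (_ : t' \in enum (diff_starts (t' - t)))) ?mem_enum // Ei nth_index ?mem_enum.
by split => //; move: E'; rewrite tu => /addrI/oppr_inj.
Qed.

Lemma slot_surj w j : w != 0 -> (j < half)%N ->
  exists t t', [/\ t \in D, t' \in D, t - t' = w & slot t t' = j].
Proof.
move=> w0 jh; have nw0 : - w != 0 by rewrite oppr_eq0.
have key v : v != 0 -> exists t, [/\ t \in D, t - v \in D & index t (enum (diff_starts v)) = j].
  move=> v0; have js : (j < size (enum (diff_starts v)))%N by rewrite -cardE diffD.
  have := mem_nth 0 js; rewrite mem_enum inE => /andP[h1 h2].
  by exists (nth 0 (enum (diff_starts v)) j); rewrite index_uniq ?enum_uniq.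
have [h|h] := boolP (enum_rank w < enum_rank (- w)%R)%N.
  have [t [h1 h2 Ej]] := key w w0; exists t, (t - w).
  have E : t - (t - w) = w by rewrite opprB addrCA subrr addr0.
  have E' : t - w - t = - w by rewrite addrAC subrr add0r.
  by split => //; rewrite /slot E E' h Ej modn_small.
have [t [h1 h2 Ej]] := key (- w) nw0; exists (t - (- w)), t.
have E : t - (- w) - t = w by rewrite opprK addrAC subrr add0r.
have E' : t - (t - (- w)) = - w by rewrite opprB addrCA subrr addr0.
by split => //; rewrite /slot E E' (negbTE h) Ej modn_small.
Qed.

End Slots.

(** The a_t get the labels z^0, ..., z^(d - 1). For w != 0 every exponent j below d is
that of exactly one value a_t - a_t' or a_t + a_t' with t - t' = w: the block of j
determines the pair, and the parity of j the sign. *)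
Lemma strong_difference_starter (H : finZmodType) (K : finFieldType) (D : {set H}) (d c : nat) :
  (8 <= d)%N -> (c * d)%N = #|K|.-1 -> ~~ odd d -> ~~ odd c -> (9 * d ^ (4 * d) <= 4 * #|K|)%N ->
  #|D| = d -> #|H|.+1 = (2 * d)%N -> (forall w : H, w != 0 -> w != - w) ->
  (forall w : H, w != 0 -> #|[set t in D | t - w \in D]| = d./2) ->
  exists_one_rotational_RBIBD (#|H| * #|K| + 1) #|H|.+1 1 [set: (H * K)%type].
Proof.
move=> d8 cd dodd codd q9 cardD cardH no2 diffD.
have d0 : (0 < d)%N by apply: leq_trans d8.
have half0 : (0 < d./2)%N by rewrite half_gt0 (leq_trans _ d8).
have dE : (2 * d./2)%N = d by rewrite mul2n halfK (negbTE dodd) subn0.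
have [z zp] : exists z : K, d.-primitive_root z.
  have q1 : (0 < #|K|.-1)%N by rewrite -cd muln_gt0 (label_exponent_gt0 d8 cd q9).
  have /hasP[g _ gp] : has (#|K|.-1).-primitive_root (enum [set x : K | x != 0]).
    apply: has_prim_root => //; rewrite ?enum_uniq //.
      apply/allP => x; rewrite mem_enum inE => x0; rewrite unity_rootE; apply/eqP.
      apply: (mulfI x0); rewrite -exprS prednK ?expf_card ?mulr1 //.
      by apply/card_gt0P; exists 0.
    rewrite -cardE -subn1 -(card1 (0 : K)) -(cardC (pred1 0)) addKn.
    by apply: subset_leq_card; apply/subsetP => x; rewrite !inE.
  exists (g ^+ c); rewrite -(_ : (#|K|.-1 %/ gcdn c #|K|.-1)%N = d); first exact: exp_prim_root.
  by rewrite -cd gcdnMr mulKn // (label_exponent_gt0 d8 cd q9).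
pose tau t := (index t (enum D) %% d)%N.
have tauD t : t \in D -> tau t = index t (enum D).
  by move=> tD; rewrite /tau modn_small // -cardD cardE index_mem mem_enum.
have [|||||a [a1 a2]] := @greedy_choice K d c z d8 cd zp dodd codd q9 H tau (slot D d./2) (enum D).
- by move=> t; apply: ltn_pmod.
- exact: slot_sym.
- by move=> t t'; move: (slot_lt D half0 t t') dE; move: (slot _ _ _ _) => sl; clear; lia.
- exact: enum_uniq.
- by rewrite -cardE cardD.
have {}a1 t : t \in D -> a t ^+ c = z ^+ tau t by move=> tD; apply: a1; rewrite mem_enum.
have {}a2 t t' : t \in D -> t' \in D -> t != t' -> paired c z (a t) (a t') (slot D d./2 t t').
  by move=> tD tD'; apply: a2; rewrite mem_enum.
have c0 := label_exponent_gt0 d8 cd q9.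
have root_label (u : K) : u != 0 -> exists2 j, (j < d)%N & u ^+ c = z ^+ j.
  move=> u0; have : (u ^+ c) ^+ d = 1.
    rewrite -exprM cd; apply: (mulfI u0); rewrite -exprS prednK ?expf_card ?mulr1 //.
    by apply/card_gt0P; exists 0.
  by move/(prim_rootP zp) => [j ->]; exists j.
have z_inj i j : (i < d)%N -> (j < d)%N -> z ^+ i = z ^+ j -> i = j.
  by move=> id jd /eqP; rewrite (eq_prim_root_expr zp) !modn_small // => /eqP.
have lab2 t t' : t \in D -> t' \in D -> t != t' ->
    exists be : bool, forall e : bool,
      (a t - (-1) ^+ e * a t') ^+ c = z ^+ (2 * slot D d./2 t t' + addb e be).
  move=> tD tD' tt; have [be [h1 h2]] := a2 _ _ tD tD' tt; exists be => -[].
    by rewrite expr1 mulN1r opprK h2; case: be {h1 h2}.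
  by rewrite expr0 mul1r h1.
have slot2 t t' (b : bool) : (2 * slot D d./2 t t' + b < d)%N.
  by move: (slot_lt D half0 t t') dE; move: (slot _ _ _ _) => sl; case: b; clear; lia.
apply: (@starter_one_rotational H K D a c) => //.
- exact: two_neq0 d8 zp dodd.
- by rewrite cardD.
- move=> u /root_label[j jd ->]; have js : (j < size (enum D))%N by rewrite -cardE cardD.
  have := mem_nth 0 js; rewrite mem_enum => tD.
  by exists (nth 0 (enum D) j) => //; rewrite a1 // tauD // index_uniq ?enum_uniq.
- move=> t t' tD tD'; rewrite !a1 // => /z_inj; rewrite !ltn_pmod // => /(_ isT isT).
  rewrite !tauD // => Ei; rewrite -(nth_index 0 (_ : t \in enum D)) ?mem_enum // Ei.
  by rewrite nth_index ?mem_enum.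
- move=> w u w0 /root_label[j jd Ej].
  have [|t [t' [tD tD' tw Es]]] := slot_surj diffD w0 (_ : j./2 < d./2)%N.
    by move: jd dE; clear; lia.
  have tt : t != t' by rewrite -subr_eq0 tw.
  have [be h] := lab2 t t' tD tD' tt.
  exists t, t', (odd j (+) be); split => //.
  by rewrite h Es -addbA addbb addbF addnC mul2n odd_double_half Ej.
- move=> t t' e u u' e' tD tD' uD uD' tt E.
  have uu : u != u' by rewrite -subr_eq0 -E subr_eq0.
  have [be h] := lab2 t t' tD tD' tt; have [be' h'] := lab2 u u' uD uD' uu.
  rewrite h h' => /z_inj; rewrite !slot2 => /(_ isT isT) Eq.
  have Es : slot D d./2 t t' = slot D d./2 u u'.
    move: Eq; move: (slot _ _ t t') (slot _ _ u u') => s1 s2.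
    by case: (e (+) be); case: (e' (+) be') => /=; clear; lia.
  have [Et Et'] := slot_inj diffD tD tD' uD uD' tt E Es.
  subst u u'; split => //.
  have : z ^+ (2 * slot D d./2 t t' + addb e be) = z ^+ (2 * slot D d./2 t t' + addb e be').
    by rewrite -h -h'.
  move/z_inj; rewrite !slot2 => /(_ isT isT) /addnI Eb.
  move: Eq => /addnI; move: Eb; by case: e {h h'}; case: e'; case: be; case: be'.
- by move=> t tD; apply: (neq0_of_label d8 cd zp q9 (a1 _ tD)).
- by move=> t t' tD tD' tt; apply: (paired_neq d8 cd zp q9 (a2 _ _ tD tD' tt)).
Qed.

(** * The theorem *)

(** Powers of 2 greater than 2 are multiples of 4, and these do not differ by 2. *)
Lemma twin_prime_power_odd p : prime_power p -> prime_power (p + 2) -> (2 < p)%N -> odd p.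
Proof.
move=> [r [e [rp e0 Ep]]] [r' [e' [rp' e0' Ep']]] p2; apply: contraT => evp.
have two (s f n : nat) : prime s -> (0 < f)%N -> n = (s ^ f)%N -> ~~ odd n -> (2 < n)%N -> (4 %| n)%N.
  move=> sp f0 En evn n2; have s2 : s = 2%N.
    move: evn; rewrite En oddX negb_or => /andP[_ evs].
    by have [//|] := even_prime sp; rewrite (negbTE evs).
  move: n2; rewrite En s2; case: f f0 {En} => [|[|f]] // _ _.
  by rewrite !expnS mulnA dvdn_mulr.
have h1 := two _ _ _ rp e0 Ep evp p2.
have := two _ _ _ rp' e0' Ep'; rewrite oddD /= addbF => /(_ evp) h2.
have := h2 (ltn_trans p2 _); rewrite -[X in (X < _)%N]addn0 ltn_add2l => /(_ isT).
by rewrite (dvdn_addr _ h1).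
Qed.

Lemma eq_opp0 (F : finFieldType) h (x : F) : x = - x -> #|F| = (2 * h).+1 -> x = 0.
Proof.
move=> Ex cardF; apply/eqP; apply: contraT => x0; have := neq_opp1 cardF.
by rewrite -(inj_eq (mulfI x0)) mulrN1 mulr1 -Ex eqxx.
Qed.

Local Close Scope ring_scope.

Theorem theorem4p12 (R : rcfType) (p q : nat) (Fp Fp2 Fq : finFieldType)
    (hp : prime_power p) (hp2 : prime_power (p + 2)) (p_gt2 : 2 < p)
    (hq : prime_power q)
    (cardFp : #|Fp| = p) (cardFp2 : #|Fp2| = p + 2) (cardFq : #|Fq| = q)
    (q_mod : q = 1 %[mod p * (p + 2) + 1])
    (q_gtQ : (Q_bound R ((p * (p + 2) + 1) %/ 2) (p * (p + 2)) < q%:R)%R) :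
  exists_one_rotational_RBIBD (p * (p + 2) * q + 1) (p * (p + 2) + 1) 1
    [set: (Fp * Fp2 * Fq)%type].
Proof.
have [h Eh] : exists h, p = (2 * h).+1.
  by exists p./2; rewrite -[LHS]odd_double_half (twin_prime_power_odd hp hp2 p_gt2) mul2n.
have h1 : 0 < h by move: p_gt2; rewrite Eh; clear; lia.
pose d := 2 * h.+1 ^ 2.
have d8 : 8 <= d by rewrite /d -mulnn; move: h1; clear; nia.
have card1 : #|Fp| = (2 * h).+1 by rewrite cardFp.
have card2 : #|Fp2| = (2 * h.+1).+1 by rewrite cardFp2 Eh; clear; lia.
have Ek : p * (p + 2) + 1 = 2 * d by rewrite Eh /d -mulnn; clear; nia.
have Em : p * (p + 2) = (2 * d).-1 by move: Ek; clear; lia.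
have dodd : ~~ odd d by rewrite /d oddM.
(* This is (q - 1) / d, written so that its evenness, which gives -1 the label 1, is visible. *)
pose c := 2 * ((q - 1) %/ (2 * d)).
have q0 : 0 < q by rewrite -cardFq; apply/card_gt0P; exists 0%R.
have cd : c * d = #|Fq|.-1.
  have dv : 2 * d %| q - 1 by rewrite -eqn_mod_dvd // -Ek; apply/eqP.
  by rewrite cardFq -subn1 -[RHS](divnK dv) /c [2 * _]mulnC -mulnA.
have q9 : 9 * d ^ (4 * d) <= 4 * #|Fq|.
  rewrite cardFq; apply: (@Q_bound_ge R) => //.
  by move: q_gtQ; rewrite Ek Em mulKn.
pose H : finZmodType := HB.pack_for finZmodType (Fp * Fp2)%type.
have cardH : #|H| = p * (p + 2) by rewrite card_prod cardFp cardFp2.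
have no2 (w : H) : w != 0%R -> w != (- w)%R.
  apply: contraNneq => Ew; have [E1 E2] : w.1 = (- w.1)%R /\ w.2 = (- w.2)%R.
    by rewrite {1 3}Ew.
  by case: w {Ew} E1 E2 => x y /= /eq_opp0/(_ card1)-> /eq_opp0/(_ card2)->.
have main : exists_one_rotational_RBIBD (#|H| * #|Fq| + 1) #|H|.+1 1 [set: (H * Fq)%type].
  apply: (@strong_difference_starter H Fq (twin_set Fp Fp2 h) d c) => //.
  - by rewrite /c oddM.
  - by rewrite (card_twin_set card1 card2).
  - by rewrite cardH -addn1.
  move=> w w0; have -> : d./2 = h.+1 ^ 2 by rewrite /d mul2n doubleK.
  have nw0 : (- w)%R != 0%R by rewrite oppr_eq0.
  by rewrite -(twin_set_diff card1 card2 nw0); apply: eq_card => z; rewrite !inE.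
by move: main; rewrite cardH cardFq -[(p * (p + 2)).+1]addn1.
Qed.
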